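(* Consider a finite discounted Markov decision process with state space $\mathbb S$, action space $\mathbb A$, transition kernel $P$, initial distribution $\mu\in\Delta_{\mathbb S}$, reward $r\in\mathbb R^{\mathbb S\times\mathbb A}$ and discount factor $\gamma\in[0,1)$. Suppose that for every policy $\pi\in\Delta_{\mathbb A}^{\mathbb S}$ one has $\sum_{a}d^\pi(s,a)>0$ for all $s\in\mathbb S$, and let $\mathbb R^p\to\operatorname{int}(\Delta_{\mathbb A}^{\mathbb S})$, $\theta\mapsto\pi_\theta$, be a differentiable policy parametrization. Let $(\theta_t)_{t\ge0}$ be a solution of the state-action natural policy gradient flow $\partial_t\theta_t=G_{\mathrm M}(\theta_t)^+\nabla R(\theta_t)$, write $d_t=d_{\theta_t}$, set $R^\star:=\max_{\pi\in\Delta_{\mathbb A}^{\mathbb S}}R(\pi)$ and let $d^\star\in\mathcal D$ satisfy $r^\top d^\star=R^\star$. Then for all $t>0$ it holds that $$R^\star-R(\theta_t)\le\frac{D_{\mathrm{KL}}(d^\star,d_0)}{t}+t^{-1}\int_0^t\delta_s\varepsilon_s\,\mathrm ds,$$ where $\delta_t^2:=\chi^2(d^\star,d_t)$ and $\varepsilon_t^2:=\min_{w\in\mathbb R^p}\left\lVert\nabla^{\mathrm{FR}}_{\mathcal D}f(d_t)-w^\top\nabla_\theta d_{\theta_t}\right\rVert^2_{g^{\mathrm{FR}}_{d_t}}$ with $f(d)=r^\top d$ (and $\delta_t,\varepsilon_t\ge0$), and $$\varepsilon_t^2\le\min_{w\in\mathbb R^p}\mathbb E_{d_t}\left[\left(w^\top\nabla_\theta\log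 d_{\theta_t}(s,a)-r(s,a)\right)^2\right].$$
   Context: $\mathbb S,\mathbb A$ are finite; $\Delta_{\mathbb Y}$ is the probability simplex over a finite set $\mathbb Y$; $P(s'|s,a)$ is the probability of moving from $s$ to $s'$ under action $a$. A policy $\pi\in\Delta_{\mathbb A}^{\mathbb S}$ is a Markov kernel $\pi(a|s)$. $\mathbb P^{\pi,\mu}$ is the law of the process $S_0\sim\mu$, $A_t\sim\pi(\cdot|S_t)$, $S_{t+1}\sim P(\cdot|S_t,A_t)$, $t\in\mathbb N=\{0,1,2,\dots\}$. The state-action distribution is $d^\pi(s,a)=(1-\gamma)\sum_{t\in\mathbb N}\gamma^t\,\mathbb P^{\pi,\mu}(S_t=s,A_t=a)$ and the reward is $R(\pi)=(1-\gamma)\mathbb E_{\mathbb P^{\pi,\mu}}[\sum_t\gamma^tr(S_t,A_t)]=r^\top d^\pi$. $\mathcal D=\{d^\pi:\pi\in\Delta_{\mathbb A}^{\mathbb S}\}\subseteq\Delta_{\mathbb S\times\mathbb A}$ is the state-action polytope (the intersection of $\Delta_{\mathbb S\times\mathbb A}$ with an affine space). Write $d_\theta=d^{\pi_\theta}$, $R(\theta)=R(\pi_\theta)$. $\operatorname{int}$ is the relative interior and $T\mathcal D$ the linear part of the affine hull of $\mathcal D$. The Fisher-Rao metric is $g^{\mathrm{FR}}_d(v,w)=\sum_{s,a}\frac{v(s,a)w(s,a)}{d(s,a)}$ with norm $\lVert v\rVert_{g^{\mathrm{FR}}_d}=g_d^{\mathrm{FR}}(v,v)^{1/2}$, and $G_{\mathrm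 M}(\theta)_{ij}=g^{\mathrm{FR}}_{d_\theta}(\partial_{\theta_i}d_\theta,\partial_{\theta_j}d_\theta)$, with Moore–Penrose pseudo-inverse $G_{\mathrm M}(\theta)^+$. $\nabla^{\mathrm{FR}}_{\mathcal D}f(d)\in T\mathcal D$ is determined by $g^{\mathrm{FR}}_d(\nabla^{\mathrm{FR}}_{\mathcal D}f(d),v)=\langle\nabla f(d),v\rangle$ for all $v\in T\mathcal D$. $D_{\mathrm{KL}}(d,d')=\sum_{s,a}d(s,a)\log\frac{d(s,a)}{d'(s,a)}$ (with $0\log\frac0{\cdot}=0$), $\chi^2(d,d')=\mathbb E_{d'}\left[\frac{(d-d')^2}{d'^2}\right]$. *)

(* Defs.v *)
From HB Require Import structures.
From mathcomp Require Import all_boot all_order all_algebra.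
From mathcomp Require Import all_classical all_reals all_analysis.
Import Order.TTheory GRing.Theory Num.Theory.
Import numFieldNormedType.Exports.

Set Implicit Arguments.
Unset Strict Implicit.
Unset Printing Implicit Defensive.

Local Open Scope classical_set_scope.
Local Open Scope ring_scope.

(** Vectors of R^X, for a finite type X, are functions X -> R. *)

Section finite_dimensional.
Context {R : realType} {X : finType}.
Implicit Types (d v w : X -> R) (C : set (X -> R)) (f : (X -> R) -> R).

Definition dot v w : R := \sum_x v x * w x.

Definition simplex : set (X -> R) :=
  [set d | (forall x, 0 <= d x) /\ \sum_x d x = 1].

Definition expect d (g : X -> R) : R := \sum_x d x * g x.

Definition affine_hull C : set (X -> R) :=
  [set v | exists n (c : 'I_n -> R) (u : 'I_n -> X -> R),
    [/\ \sum_i c i = 1, forall i, C (u i) & v = \sum_i c i *: u i]].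

(** Linear part of the affine hull. *)
Definition tangent C : set (X -> R) :=
  [set v | exists u w, [/\ affine_hull C u, affine_hull C w & v = u - w]].

(** Relative interior; on R^X the sup-norm defines the usual topology. *)
Definition relint C : set (X -> R) :=
  [set v | C v /\ exists2 e, 0 < e &
    forall w, affine_hull C w -> (forall x, `|w x - v x| < e) -> C w].

Definition grad f d : X -> R :=
  fun x => derive1 (fun h : R => f (fun y => d y + h * (y == x)%:R)) 0.

Definition gFR d v w : R := \sum_x v x * w x / d x.

Definition normFR d v : R := Num.sqrt (gFR d v v).

(** Fisher-Rao gradient of f at d along C, characterized by duality. It exists
    and is unique if C is nonempty and d is everywhere positive. *)
Definition gradFR C f d : X -> R :=
  xget (0 : X -> R) [set u | tangent C u /\
    forall v, tangent C v -> gFR d u v = dot (grad f d) v].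

(** The term of index x is 0 if d x = 0, whatever the value of [ln]. The
    conventional value +oo for d x > 0 = d' x is not encoded: this divergence is
    only meant for everywhere positive d'. *)
Definition DKL d d' : R := \sum_x d x * ln (d x / d' x).

Definition chi2 d d' : R := expect d' (fun x => (d x - d' x) ^+ 2 / d' x ^+ 2).

End finite_dimensional.

Section moore_penrose.
Context {R : realType}.

Definition is_moore_penrose m n (G : 'M[R]_(m, n)) (H : 'M[R]_(n, m)) :=
  [/\ G *m H *m G = G, H *m G *m H = H,
      (G *m H)^T = G *m H & (H *m G)^T = H *m G].

Definition moore_penrose m n (G : 'M[R]_(m, n)) : 'M[R]_(n, m) :=
  xget 0 [set H | is_moore_penrose G H].

Lemma mul_trmx_eq0 m n (B : 'M[R]_(m, n)) : B *m B^T = 0 -> B = 0.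
Proof.
move=> B0; apply/matrixP => i j; rewrite !mxE.
have /eqP : (B *m B^T) i i = 0 by rewrite B0 mxE.
rewrite mxE psumr_eq0 => [/allP/(_ j)|k _]; last first.
  by rewrite mxE -expr2 sqr_ge0.
by rewrite mem_index_enum mxE mulf_eq0 orbb => /(_ isT)/eqP.
Qed.

Lemma row_free_gram m n (B : 'M[R]_(m, n)) : row_free B -> B *m B^T \in unitmx.
Proof.
move=> fB; rewrite -row_free_unit -kermx_eq0; apply/eqP.
set K := kermx _; have KB : K *m B = 0.
  apply: mul_trmx_eq0; rewrite trmx_mul mulmxA -[K *m B *m B^T]mulmxA.
  by rewrite mulmx_ker mul0mx.
by apply: (row_free_inj fB); rewrite KB mul0mx.
Qed.

Lemma moore_penroseP m n (G : 'M[R]_(m, n)) :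
  is_moore_penrose G (moore_penrose G).
Proof.
apply: xgetPex; rewrite -(mulmx_base G).
move: (row_base G) (col_base G) (row_base_free G) (col_base_full G).
move: (\rank G) => k B C freeB fullC.
have uB := row_free_gram freeB.
have uC : C^T *m C \in unitmx.
  by have := @row_free_gram _ _ C^T; rewrite trmxK; apply; rewrite /row_free mxrank_tr.
move Eb : (invmx (B *m B^T)) => b; move Ec : (invmx (C^T *m C)) => c.
have bT : b^T = b by rewrite -Eb trmx_inv trmx_mul trmxK.
have cT : c^T = c by rewrite -Ec trmx_inv trmx_mul trmxK.
have Bb q (Y : 'M[R]_(k, q)) : B *m (B^T *m (b *m Y)) = Y.
  by rewrite !mulmxA -Eb mulmxV ?mul1mx.
have cC q (Y : 'M[R]_(k, q)) : c *m (C^T *m (C *m Y)) = Y.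
  have -> : c *m (C^T *m (C *m Y)) = c *m (C^T *m C) *m Y by rewrite !mulmxA.
  by rewrite -Ec mulVmx ?mul1mx.
exists (B^T *m b *m (c *m C^T)).
have E1 : C *m B *m (B^T *m b *m (c *m C^T)) = C *m (c *m C^T).
  by rewrite -!mulmxA Bb.
have E2 : B^T *m b *m (c *m C^T) *m (C *m B) = B^T *m (b *m B).
  by rewrite -!mulmxA cC.
split; rewrite /= ?E1 ?E2.
- by rewrite -!mulmxA cC.
- by rewrite -!mulmxA Bb.
- by rewrite !trmx_mul trmxK cT mulmxA.
- by rewrite !trmx_mul trmxK bT mulmxA.
Qed.

End moore_penrose.

Section parametrized.
Context {R : realType} {X : finType} {p : nat}.

Definition basis_vector (i : 'I_p) : 'cV[R]_p := delta_mx i 0.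

Definition nabla (F : 'cV[R]_p -> R) (th : 'cV[R]_p) : 'cV[R]_p :=
  \col_i 'D_(basis_vector i) F th.

Implicit Types (D : 'cV[R]_p -> X -> R) (th w : 'cV[R]_p).

Definition partial D th (i : 'I_p) : X -> R :=
  fun x => nabla (D ^~ x) th i 0.

Definition gram D th : 'M[R]_p :=
  \matrix_(i, j) gFR (D th) (partial D th i) (partial D th j).

(** [wnabla D th w] is the vector w^T nabla D(th) of R^X. *)
Definition wnabla D th w : X -> R := fun x => \sum_i w i 0 * partial D th i x.

(** These infima are minima, see [eps2_attained] and
    [compatible_error_attained]. *)
Definition eps2 D (C : set (X -> R)) (f : (X -> R) -> R) th : R :=
  inf [set normFR (D th) (gradFR C f (D th) - wnabla D th w) ^+ 2
      | w in [set: 'cV[R]_p]].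

Definition compatible_error D (r : X -> R) th : R :=
  inf [set expect (D th)
        (fun x => (wnabla (fun th' y => ln (D th' y)) th w x - r x) ^+ 2)
      | w in [set: 'cV[R]_p]].

Lemma inf_minimizer (F : 'cV[R]_p -> R) w :
  (forall w', F w <= F w') -> inf [set F w' | w' in [set: 'cV[R]_p]] = F w.
Proof.
move=> Fw; apply/eqP; rewrite eq_le; apply/andP; split.
  apply: ge_inf; last by exists w.
  by exists (F w) => _ [w' _ <-].
by apply: lb_le_inf => [|_ [w' _ <-]//]; exists (F w), w.
Qed.

Lemma least_squares (c b : X -> R) (a : 'I_p -> X -> R) :
  (forall x, 0 <= c x) ->
  exists w : 'cV[R]_p, forall w' : 'cV[R]_p,
    \sum_x c x * (b x - \sum_i w i 0 * a i x) ^+ 2 <=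
    \sum_x c x * (b x - \sum_i w' i 0 * a i x) ^+ 2.
Proof.
move=> c0.
pose M : 'M[R]_(p, #|X|) :=
  \matrix_(i, j) (Num.sqrt (c (enum_val j)) * a i (enum_val j)).
pose bv : 'rV[R]_#|X| :=
  \row_j (Num.sqrt (c (enum_val j)) * b (enum_val j)).
have FE (w : 'cV[R]_p) : \sum_x c x * (b x - \sum_i w i 0 * a i x) ^+ 2 =
    ((bv - w^T *m M) *m (bv - w^T *m M)^T) 0 0.
  rewrite mxE (reindex (@enum_val X X)) /=; last first.
    by apply: onW_bij; exact: enum_val_bij.
  apply: eq_bigr => j _.
  set res := b _ - _.
  have -> : (bv - w^T *m M) 0 j = Num.sqrt (c (enum_val j)) * res.
    rewrite !mxE mulrBr mulr_sumr; congr (_ - _); apply: eq_bigr => i _.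
    by rewrite !mxE mulrCA.
  rewrite [X in _ = _ * X]mxE.
  have -> : (bv - w^T *m M) 0 j = Num.sqrt (c (enum_val j)) * res.
    rewrite !mxE mulrBr mulr_sumr; congr (_ - _); apply: eq_bigr => i _.
    by rewrite !mxE mulrCA.
  by rewrite -expr2 exprMn sqr_sqrtr.
have /submxP[u bu] : (bv *m M^T <= M *m M^T)%MS.
  apply: submx_trans (submxMl _ _) _.
  have /andP[] // : (M *m M^T == M^T)%MS.
  rewrite -(geq_leqif (mxrank_leqif_eq (submxMl M M^T))) mxrank_tr.
  rewrite -[X in (X <= _)%N](mxrank_mul_ker M M^T).
  suff -> : (M :&: kermx M^T)%MS = 0 by rewrite mxrank0 addn0.
  apply/eqP; rewrite -submx0; apply/rV_subP => v.
  rewrite sub_capmx => /andP[/submxP[t ->]] /sub_kermxP tM.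
  rewrite submx0; apply/eqP/mul_trmx_eq0.
  by rewrite trmx_mul mulmxA tM mul0mx.
exists u^T => w'; rewrite !FE trmxK.
set e := bv - u *m M.
have eM : e *m M^T = 0 by rewrite /e mulmxBl bu mulmxA subrr.
pose z := u - w'^T.
have -> : bv - w'^T *m M = e + z *m M.
  by rewrite /e /z mulmxBl addrA subrK.
clearbody e z.
have zMe : z *m M *m e^T = 0.
  by apply: trmx_inj; rewrite !trmx_mul trmxK mulmxA eM mul0mx trmx0.
have eMz : e *m (z *m M)^T = 0 by rewrite trmx_mul mulmxA eM mul0mx.
have -> : (e + z *m M)^T = e^T + (z *m M)^T by rewrite linearD.
rewrite mulmxDl !mulmxDr zMe eMz addr0 add0r.
rewrite [X in _ <= X]mxE lerDl [X in _ <= X]mxE sumr_ge0 // => j _.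
by rewrite [X in _ * X]mxE -expr2 sqr_ge0.
Qed.

Lemma eps2_attained D C f th : (forall x, 0 <= D th x) ->
  exists w,
    eps2 D C f th = normFR (D th) (gradFR C f (D th) - wnabla D th w) ^+ 2.
Proof.
move=> D0; set g := gradFR C f (D th).
have [x|w wmin] := @least_squares (fun x => (D th x)^-1) g (partial D th).
  by rewrite invr_ge0.
exists w; apply: inf_minimizer => w'.
have E v : normFR (D th) (g - wnabla D th v) ^+ 2 =
    \sum_x (D th x)^-1 * (g x - \sum_i v i 0 * partial D th i x) ^+ 2.
  rewrite /normFR sqr_sqrtr; last first.
    by apply: sumr_ge0 => x _; rewrite -expr2 divr_ge0 ?sqr_ge0.
  by apply: eq_bigr => x _; rewrite -expr2 mulrC.
by rewrite !E.
Qed.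

Lemma compatible_error_attained D r th : (forall x, 0 <= D th x) ->
  exists w, compatible_error D r th =
    expect (D th)
      (fun x => (wnabla (fun th' y => ln (D th' y)) th w x - r x) ^+ 2).
Proof.
move=> D0; set L := fun th' y => ln (D th' y).
have [w wmin] := least_squares r (partial L th) D0.
exists w; apply: inf_minimizer => w'.
have E v : expect (D th) (fun x => (wnabla L th v x - r x) ^+ 2) =
    \sum_x D th x * (r x - \sum_i v i 0 * partial L th i x) ^+ 2.
  by apply: eq_bigr => x _; rewrite -sqrrN opprB.
by rewrite !E.
Qed.

End parametrized.

(** theta has derivative v at t, as a function on [0, +oo[ (one-sided at 0). *)
Definition has_derivative_nonneg {R : realType} {p : nat} (theta : R -> 'cV[R]_p)
    (t : R) (v : 'cV[R]_p) : Prop :=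
  h^-1 *: (theta (t + h) - theta t)
    @[h --> within [set h | 0 <= t + h] (0 : R)^'] --> v.

Section mdp.
Context {R : realType} {S A : finType}.

(** pi (s, a) is the probability pi(a|s), and P s a s' is P(s'|s,a). *)
Definition policy : set (S * A -> R) :=
  [set pi | forall s, simplex (fun a => pi (s, a))].

Section process.
Context {dsp : measure_display} {Omega : measurableType dsp}.
Variables (St : nat -> Omega -> S) (At : nat -> Omega -> A).

(** Under Pr: S_0 ~ mu, A_t ~ pi(.|S_t) and S_(t+1) ~ P(.|S_t, A_t), expressed
    by the finite-dimensional distributions. *)
Definition is_mdp_law (P : S -> A -> S -> R) (mu : S -> R) (pi : S * A -> R)
    (Pr : probability Omega R) : Prop :=
  [/\ forall t s, measurable [set w | St t w = s],
      forall t a, measurable [set w | At t w = a] &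
      forall n (s : nat -> S) (a : nat -> A),
        Pr [set w | forall t, (t <= n)%N -> St t w = s t /\ At t w = a t] =
        (mu (s 0%N) * (\prod_(t < n.+1) pi (s t, a t)) *
         \prod_(t < n) P (s t) (a t) (s t.+1))%:E].

Definition occupancy (gamma : R) (Pr : probability Omega R) : S * A -> R :=
  fun x => (1 - gamma) * limn (series (fun t =>
    gamma ^+ t * fine (Pr [set w | St t w = x.1 /\ At t w = x.2]))).

Definition reward (gamma : R) (r : S * A -> R) (Pr : probability Omega R) : R :=
  (1 - gamma) * fine ('E_Pr[fun w => limn (series (fun t =>
    gamma ^+ t * r (St t w, At t w)))]).

End process.

End mdp.

(* Main.v *)
Require Import Defs.
From HB Require Import structures.
From mathcomp Require Import all_boot all_order all_algebra.
From mathcomp Require Import all_classical all_reals all_analysis.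
From mathcomp Require Import measurable_realfun ring lra.
Import Order.TTheory GRing.Theory Num.Theory.
Import numFieldNormedType.Exports.
Local Open Scope classical_set_scope.
Local Open Scope ring_scope.

(** Everything happens on the state-action polytope, where the problem is the
linear program of maximizing r^T d and the flow is its Fisher-Rao natural
gradient flow.

Write d_t for the curve of state-action distributions, u_t for the Fisher-Rao
gradient of the reward at d_t, y_t for the velocity of d_t, and
g_t for the metric at d_t. Two facts give the estimate. First, the
pseudo-inverse in the flow solves the normal equations of the least squares
problem defining eps_t, so y_t is the orthogonal projection of u_t onto the
span of the partial derivatives ([moore_penrose_projection]) and
eps_t = |u_t - y_t|. In particular dR/dt = |y_t|^2 >= 0, so the reward is
nondecreasing ([reward_nondecreasing]). Second, since y_t sums to zero, the
derivative of the divergence D_KL(d*, d_t) is - g_t(d* - d_t, y_t). Splitting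
y_t = u_t - (u_t - y_t) and using that u_t represents the reward,
   d/dt D_KL(d*, d_t) <= - (R* - R(theta_t)) + |d* - d_t| |u_t - y_t|
by Cauchy-Schwarz, and |d* - d_t| in g_t is the square root of the chi-square
divergence, delta_t ([suboptimality_le]). Integrating over [0, t], and using
that the divergence is nonnegative and R nondecreasing, gives the bound
([natural_gradient_flow_bound]). The bound on eps_t holds because u_t is the
projection onto the tangent space of the ambient gradient d_t r
([gradFR_dist_le]).

The integration needs care. The parametrization is merely differentiable and
the pseudo-inverse is discontinuous, so the velocity y_t, hence eps_t, need not
be continuous in t. The divergence is however Lipschitz on [0, t], because
projecting does not increase norms and so |y_t|^2 <= sum_x r(x)^2. For a
function that is differentiable with bounded derivative, dominated convergence
applied to difference quotients recovers the increment from the integral of the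
derivative ([increment_le_lower_integral]). Only the derivative has to be
measurable there, and it is, as a limit of continuous functions. The integral
of the upper bound delta eps is by definition a supremum of integrals of simple
functions, and is monotone without any measurability.

The decision process enters through the geometry of its distributions. The law
of (S_t, A_t) satisfies a linear recursion ([marginal_law]), so the discounted
law solves a fixed-point equation, whose solution is unique because the
transition operator contracts the l^1-norm by gamma ([stationary_eq0]).
Cramer's rule then shows that the discounted law is a differentiable function of
the parameters ([differentiable_discounted_law]), and uniqueness shows that
every positive solution of the flow constraints is a state-action distribution,
so that the tangent space of the polytope is the kernel of these constraints
([tangent_occupancy_polytope]). *)

Set Implicit Arguments.
Unset Strict Implicit.

(** * Increments and lower integrals of derivatives *)

(** The integral of a nonnegative function is a supremum over simple functions
below it, whether or not it is measurable. *)
Lemma le_lower_integral (d : measure_display) (T : measurableType d)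
    (R : realType) (mu : {measure set T -> \bar R}) (D E : set T)
    (f g : T -> \bar R) :
  D `<=` E -> (forall x, D x -> 0 <= f x)%E -> (forall x, E x -> 0 <= g x)%E ->
  (forall x, D x -> f x <= g x)%E ->
  (\int[mu]_(x in D) f x <= \int[mu]_(x in E) g x)%E.
Proof.
move=> DE f0 g0 fg; rewrite !ge0_integralE//.
apply: ereal_sup_le => _ [h /= hf <-]; exists h => // x /=.
apply: le_trans (hf x) _; rewrite /patch.
case: ifPn => xD; case: ifPn => xE //.
- by rewrite inE in xD; exact: fg.
- by rewrite inE in xD; move/negP: xE; rewrite inE => /(_ (DE _ xD)).
- by rewrite inE in xE; exact: g0.
Qed.

Lemma derivable_dist_le (R : realType) (F f : R -> R) (a b M : R) :
  continuous F -> (forall x, a < x < b -> is_derive x (1 : R) F (f x)) ->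
  (forall x, a < x < b -> `|f x| <= M) ->
  forall x y, a <= x -> x <= y -> y <= b -> `|F y - F x| <= M * (y - x).
Proof.
move=> cF dF fM x y ax; rewrite le_eqVlt => /predU1P[<-|xy] yb.
  by rewrite !subrr normr0 mulr0.
have [|c cxy ->] := @MVT R F f x y xy _ (@continuous_subspaceT _ _ _ _ cF).
  move=> z /[!in_itv]/= /andP[xz zy].
  by apply: dF; rewrite (le_lt_trans ax xz) (lt_le_trans zy yb).
have yx : 0 <= y - x by rewrite subr_ge0 ltW.
rewrite normrM (ger0_norm yx) ler_wpM2r// fM//.
move: cxy; rewrite in_itv/= => /andP[xc cy].
by rewrite (le_lt_trans ax xc) (lt_le_trans cy yb).
Qed.

(** If H is a primitive of G, the difference quotient of G with step h has the
primitive (H(x + h) - H(x)) / h, whose values at a and b tend to G(a) and G(b).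
This evaluates the integral without translating the measure. *)
Lemma integral_shift_difference (R : realType) (G : R -> R) (a b : R) :
  a < b -> continuous G ->
  exists K : R -> R, K h @[h --> 0^'] --> G b - G a /\
    forall h, 0 < h <= 1 ->
      (\int[lebesgue_measure]_(x in `]a, b[) ((G (x + h) - G x) / h)%:E =
       (K h)%:E)%E.
Proof.
move=> ab cG.
(* H is differentiable only in the interior of its interval of definition, which
   must contain a, b and their translates by h <= 1. *)
pose H x := (\int[lebesgue_measure]_(t in `[(a - 1)%R, x]) G t)%R.
have dH (x : R) : a - 1 < x -> x < b + 2 -> is_derive x (1 : R) H (G x).
  move=> ax xb.
  have Gi : lebesgue_measure.-integrable `[a - 1, b + 2] (EFin \o G).
    apply: continuous_compact_integrable; first exact: segment_compact.
    exact: continuous_subspaceT.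
  have [dx Hx] := continuous_FTC1_closed xb Gi ax (cG x).
  by apply: DeriveDef => //; rewrite -derive1E.
exists (fun h => h^-1 * (H (b + h) - H b) - h^-1 * (H (a + h) - H a)); split.
  have key (x : R) : a - 1 < x -> x < b + 2 ->
      h^-1 * (H (x + h) - H x) @[h --> 0^'] --> G x.
    move=> ax xb; have [Hd <-] := dH x ax xb.
    apply: cvg_trans Hd; apply: near_eq_cvg; near=> h.
    by rewrite /shift /= [h%:A]mulr1 (addrC h).
  by apply: cvgB; apply: key; lra.
move=> h /andP[h0 h1].
have cq : continuous (fun x => (G (x + h) - G x) / h).
  move=> x; apply: cvgM; last exact: cvg_cst.
  apply: cvgB; last exact: cG.
  apply: continuous_comp; last exact: cG.
  by apply: cvgD; [exact: cvg_id|exact: cvg_cst].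
have mq : measurable_fun `]a, b[ (fun x => ((G (x + h) - G x) / h)%:E).
  apply/measurable_EFinP; apply: measurable_funTS.
  by apply: continuous_measurable_fun; exact: cq.
rewrite -(@integral_itv_bndoo _ _ _ _ true false mq).
pose K x := h^-1 * (H (x + h) - H x).
have dK (x : R) : a - 1 < x -> x < b + 1 ->
    is_derive x (1 : R) K ((G (x + h) - G x) / h).
  move=> ax xb; rewrite mulrC.
  have d1 : is_derive x (1 : R) (fun z => H (z + h)) (G (x + h)).
    have dHx : is_derive (x + h) (1 : R) H (G (x + h)) by apply: dH; lra.
    have := @is_derive1_comp R H (fun z => z + h) x (G (x + h)) 1 dHx.
    rewrite mulr1; apply.
    by have := @is_deriveD _ _ _ id (cst h) x 1 1 0 _ _; rewrite addr0; exact.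
  have d2 : is_derive x (1 : R) H (G x) by apply: dH; lra.
  exact: (is_deriveZ (h^-1) (is_deriveB d1 d2)).
rewrite (@continuous_FTC2 R _ K a b ab).
- rewrite -EFinB; congr EFin; rewrite /K; ring.
- exact: continuous_subspaceT.
- have cK x : a - 1 < x -> x < b + 1 -> K z @[z --> x] --> K x.
    move=> ax xb; have [dx _] := dK x ax xb.
    by apply: differentiable_continuous; exact/derivable1_diffP.
  split.
  + by move=> x /[!in_itv]/= /andP[ax xb]; have [|//|//] := dK x; lra.
  + by apply: cvg_at_right_filter; apply: cK; lra.
  + by apply: cvg_at_left_filter; apply: cK; lra.
- move=> x /[!in_itv]/= /andP[ax xb].
  by have [|//|_] := dK x; [lra|lra|rewrite derive1E].
Unshelve. all: by end_near. Qed.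

(** Everywhere differentiability together with a bounded derivative recovers the
increment from the Lebesgue integral of a possibly discontinuous derivative:
the difference quotients are uniformly bounded by the mean value theorem and
converge pointwise, so their integrals converge to the integral of f by
dominated convergence, and to the increment by [integral_shift_difference].
The upper bound g may be non-measurable, since only monotonicity of the lower
integral is used for it. *)
Theorem increment_le_lower_integral (R : realType) (F f g : R -> R)
    (a b M : R) :
  a < b -> continuous F ->
  (forall x, a < x < b -> is_derive x (1 : R) F (f x)) ->
  (forall x, a < x < b -> `|f x| <= M) ->
  (forall x, a < x < b -> f x <= g x) -> (forall x, 0 <= g x) ->
  ((F b - F a)%:E <= \int[lebesgue_measure]_(x in `[a, b]) (g x)%:E)%E.
Proof.
move=> ab cF dF fM fg g0.
(* Freezing F after b keeps the difference quotients bounded near b, where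
   x + h leaves the interval on which the derivative is controlled. *)
pose G x := F (Num.min x b).
have cG : continuous G.
  move=> x; apply: continuous_comp; last exact: cF.
  by apply: (@continuous_min R R id (cst b) x); [exact: cvg_id|exact: cvg_cst].
have M0 : 0 <= M.
  by apply: le_trans (fM ((a + b) / 2) _); rewrite ?normr_ge0//; lra.
have GL x y : a <= x -> x <= y -> `|G y - G x| <= M * (y - x).
  move=> ax xy.
  have [K1 K2] :
      Num.min x b <= Num.min y b /\ Num.min y b - Num.min x b <= y - x.
    by rewrite /Num.min; case: ifPn; case: ifPn => //; rewrite -?leNgt; lra.
  apply: le_trans (derivable_dist_le cF dF fM _ _ _) _ => //.
  - by rewrite le_min ax ltW.
  - by rewrite ge_min lexx orbT.
  - by rewrite ler_wpM2l.
have [K [K0 KE]] := integral_shift_difference ab cG.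
pose h : nat -> R := harmonic.
have h01 n : 0 < h n <= 1 by rewrite harmonic_gt0/= invf_le1// ler1n.
have hcvg : h n @[n --> \oo] --> (0 : R)^'.
  move=> P /= nP.
  have H : \forall n \near \oo, h n != 0 -> P (h n) by exact: cvg_harmonic nP.
  change (\forall n \near \oo, P (h n)).
  by apply: filterS H => n /=; apply; rewrite gt_eqF//; case/andP: (h01 n).
pose q n x := (G (x + h n) - G x) / h n.
have cq n : continuous (q n).
  move=> x; apply: cvgM; last exact: cvg_cst.
  apply: cvgB; last exact: cG.
  apply: continuous_comp; last exact: cG.
  by apply: cvgD; [exact: cvg_id|exact: cvg_cst].
have mq n : measurable_fun `]a, b[ (q n).
  by apply: measurable_funTS; apply: continuous_measurable_fun; exact: cq.
have qf x : a < x < b -> q n x @[n --> \oo] --> f x.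
  move=> axb; have [Fd <-] := dF x axb; case/andP: axb => ax xb.
  apply: cvg_trans (cvg_comp _ _ hcvg Fd); apply: near_eq_cvg; near=> n.
  rewrite /q /shift/= [_ *: 1]mulr1 [RHS]mulrC.
  have hn : h n < b - x.
    by near: n; apply: (cvgr_lt 0 cvg_harmonic); rewrite subr_gt0.
  have xh : x + h n <= b by lra.
  by rewrite /G (min_l xh) (min_l (ltW xb)) (addrC x).
have mf : measurable_fun `]a, b[ f.
  apply: (@measurable_fun_cvg _ _ _ _ q) => [n|x /=]; first exact: mq.
  by rewrite in_itv/=; exact: qf.
have mD : measurable `]a, b[%classic by exact: measurable_itv.
have iM : lebesgue_measure.-integrable `]a, b[ (EFin \o cst M).
  apply: measurable_bounded_integrable => //.
    by rewrite /= lebesgue_measure_itv/= lte_fin ab -EFinB ltry.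
  exists M; split; first exact: num_real.
  by move=> y My x _ /=; rewrite ger0_norm// ltW.
have mqE n : measurable_fun `]a, b[ (EFin \o q n) by exact/measurable_EFinP.
have mfE : measurable_fun `]a, b[ (EFin \o f) by exact/measurable_EFinP.
have qfE : {ae lebesgue_measure, forall x, `]a, b[%classic x ->
    (EFin \o q n) x @[n --> \oo] --> (EFin \o f) x}.
  apply: aeW => x /=; rewrite in_itv/= => /qf xf.
  by apply: cvg_EFin; [exact: nearW|exact: xf].
have qM : {ae lebesgue_measure, forall x n, `]a, b[%classic x ->
    (`|(EFin \o q n) x| <= (EFin \o cst M) x)%E}.
  apply: aeW => x n /=; rewrite in_itv/= lee_fin => /andP[ax xb].
  have /andP[hn _] := h01 n.
  have hV : 0 <= (h n)^-1 by rewrite invr_ge0 ltW.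
  have xh : x <= x + h n by rewrite lerDl ltW.
  rewrite normrM (ger0_norm hV) ler_pdivrMr//.
  by apply: le_trans (GL _ _ (ltW ax) xh) _; rewrite [x + _]addrC addrK.
have [fi _ qI] := @dominated_convergence _ _ R lebesgue_measure _ mD
  (fun n => EFin \o q n) _ _ mqE mfE qfE iM qM.
have fE : (\int[lebesgue_measure]_(x in `]a, b[) (f x)%:E = (F b - F a)%:E)%E.
  have Gab : G b - G a = F b - F a by rewrite /G !min_l// ltW.
  have Kh : (K (h n))%:E @[n --> \oo] --> (F b - F a)%:E.
    rewrite -Gab; apply: cvg_EFin; first exact: nearW.
    exact: cvg_comp _ _ hcvg K0.
  apply: cvg_unique qI _ => //; apply: cvg_trans Kh; apply: near_eq_cvg.
  by apply: nearW => n /=; rewrite -KE.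
rewrite -fE.
apply: le_trans
  (_ : \int[lebesgue_measure]_(x in `]a, b[) ((EFin \o f)^\+ x) <= _)%E.
  apply: le_integral => //; first exact: integrable_funepos.
  by move=> x _; rewrite /= funeposE le_max lexx.
apply: le_lower_integral.
- exact: subset_itv_oo_cc.
- by move=> x _; rewrite funeposE le_max lexx orbT.
- by move=> x _; rewrite lee_fin.
- move=> x; rewrite /= in_itv/= => /fg fgx.
  by rewrite funeposE ge_max !lee_fin fgx g0.
Unshelve. all: by end_near. Qed.

(** * Differentiability of sums, determinants and compositions *)

Lemma is_derive_bigsum (R : realType) (V : normedModType R) (I : Type)
    (s : seq I) (f : I -> V -> R) (df : I -> R) (x v : V) :
  (forall i, is_derive x v (f i) (df i)) ->
  is_derive x v (fun z => \sum_(i <- s) f i z) (\sum_(i <- s) df i).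
Proof.
move=> fdf; elim: s => [|i s IH].
  under eq_fun do rewrite big_nil; rewrite big_nil; exact: is_derive_cst.
under eq_fun do rewrite big_cons; rewrite big_cons.
exact: is_deriveD (fdf i) IH.
Qed.

Section differentiable_det.
Context {R : realType} {V : normedModType R}.
Implicit Types x : V.

Lemma differentiable_bigsum (I : Type) (s : seq I) (Q : pred I)
    (f : I -> V -> R) x :
  (forall i, differentiable (f i) x) ->
  differentiable (fun v => \sum_(i <- s | Q i) f i v) x.
Proof.
move=> df; elim: s => [|i s IH].
  by under eq_fun do rewrite big_nil; exact: differentiable_cst.
under eq_fun do rewrite big_cons; case: (Q i) => //.
exact: differentiableD.
Qed.

Lemma differentiable_bigprod (I : Type) (s : seq I) (f : I -> V -> R) x :
  (forall i, differentiable (f i) x) ->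
  differentiable (fun v => \prod_(i <- s) f i v) x.
Proof.
move=> df; elim: s => [|i s IH].
  by under eq_fun do rewrite big_nil; exact: differentiable_cst.
under eq_fun do rewrite big_cons.
exact: differentiableM.
Qed.

Lemma differentiable_det n (M : V -> 'M[R]_n) x :
  (forall i j, differentiable (fun v => M v i j) x) ->
  differentiable (fun v => \det (M v)) x.
Proof.
move=> dM; apply: differentiable_bigsum => s.
apply: differentiableM; first exact: differentiable_cst.
exact: differentiable_bigprod.
Qed.

Lemma differentiable_adj n (M : V -> 'M[R]_n) x :
  (forall i j, differentiable (fun v => M v i j) x) ->
  forall i j, differentiable (fun v => (\adj (M v)) i j) x.
Proof.
move=> dM i j; under eq_fun do rewrite mxE.
apply: differentiableM; first exact: differentiable_cst.
apply: differentiable_det => k l; under eq_fun do rewrite !mxE.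
exact: dM.
Qed.

(** By Cramer's rule the solution of a linear system is a rational function of
its coefficients. *)
Lemma differentiable_cramer n (K : V -> 'M[R]_n) (b z : V -> 'rV[R]_n) x :
  (forall i j, differentiable (fun v => K v i j) x) ->
  (forall j, differentiable (fun v => b v 0 j) x) ->
  (forall v, \det (K v) != 0) -> (forall v, z v *m K v = b v) ->
  forall j, differentiable (fun v => z v 0 j) x.
Proof.
move=> dK db K0 zK j.
have zE v : z v 0 j = (b v *m \adj (K v)) 0 j * (\det (K v))^-1.
  rewrite -zK -mulmxA mul_mx_adj mul_mx_scalar mxE mulrC mulrA.
  by rewrite mulVf ?mul1r.
under eq_fun do rewrite zE mxE.
apply: differentiableM.
  apply: differentiable_bigsum => i; apply: differentiableM; first exact: db.
  exact: differentiable_adj.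
apply: differentiable_comp; first exact: differentiable_det.
by apply: differentiable_Rinv.
Qed.

End differentiable_det.

Section chain_rule.
Context {R : realType} {p : nat}.
Implicit Types (F : 'cV[R]_p -> R) (th w : 'cV[R]_p) (theta : R -> 'cV[R]_p).

Lemma diff_nabla F th w : differentiable F th ->
  'd F th w = \sum_i w i 0 * nabla F th i 0.
Proof.
move=> dF.
have wE : w = \sum_i w i 0 *: basis_vector i.
  rewrite [LHS]matrix_sum_delta; apply: eq_bigr => i _.
  by rewrite big_ord1.
rewrite {1}wE linear_sum; apply: eq_bigr => i _.
by rewrite linearZ mxE deriveE.
Qed.

Lemma is_derive_along_curve F theta w (t : R) :
  differentiable F (theta t) -> is_derive t (1 : R) theta w ->
  is_derive t (1 : R) (F \o theta) (\sum_i w i 0 * nabla F (theta t) i 0).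
Proof.
move=> dF [dth <-].
have dth' : differentiable theta t by exact/derivable1_diffP.
have dFth : differentiable (F \o theta) t by exact: differentiable_comp.
apply: DeriveDef; first exact: diff_derivable.
by rewrite deriveE// diff_comp//= -diff_nabla// deriveE.
Qed.

Lemma nabla_ln F th i : differentiable F th -> 0 < F th ->
  nabla (fun th' => ln (F th')) th i 0 = nabla F th i 0 / F th.
Proof.
move=> dF F0; rewrite !mxE.
have dln : is_derive (F th) (1 : R) (@ln R) (F th)^-1 by exact: is_derive1_ln.
have dln' : differentiable (@ln R) (F th) by apply/derivable1_diffP; case: dln.
rewrite !deriveE//; last exact: differentiable_comp.
rewrite (@diff_comp _ _ _ _ F (@ln R))//= mulrC.
have -> : 'd F th (basis_vector i) = 'd F th (basis_vector i) *: (1 : R).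
  by rewrite [RHS]mulr1.
rewrite linearZ /= -[X in _ *: X]deriveE// (@derive_val _ _ _ _ _ _ _ dln).
by rewrite [_%:A]mulr1 [LHS]mulrC.
Qed.

Lemma nabla_dot (X : finType) (r : X -> R) (D : 'cV[R]_p -> X -> R) th i :
  (forall x, differentiable (D ^~ x) th) ->
  nabla (fun th' => dot r (D th')) th i 0 = dot r (partial D th i).
Proof.
move=> dD; rewrite mxE /dot.
have dr x : is_derive th (basis_vector i) (fun th' => r x * D th' x)
    (r x * partial D th i x).
  rewrite /partial mxE.
  have dDx : is_derive th (basis_vector i) (D ^~ x)
      ('D_(basis_vector i) (D ^~ x) th).
    by apply: DeriveDef => //; exact: diff_derivable.
  exact: (is_deriveZ (r x) dDx).
exact: (@derive_val _ _ _ _ _ _ _ (is_derive_bigsum (index_enum X) dr)).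
Qed.

End chain_rule.

Section flow_curve.
Context {R : realType} {p : nat}.
Variables (theta : R -> 'cV[R]_p) (v : R -> 'cV[R]_p).
Hypothesis flow : forall t : R, 0 <= t -> has_derivative_nonneg theta t (v t).

(** At t > 0 the one-sided domain contains a neighbourhood of t. *)
Lemma is_derive_flow (t : R) : 0 < t -> is_derive t (1 : R) theta (v t).
Proof.
move=> t0; have Hd : h^-1 *: ((theta \o shift t) (h *: 1) - theta t)
    @[h --> (0 : R)^'] --> v t.
  have := flow (ltW t0); rewrite /has_derivative_nonneg => Hd.
  have W : (0 : R)^' --> within [set h | 0 <= t + h] (0 : R)^'.
    move=> Q HQ; change (\forall h \near (0 : R)^', Q h).
    have {}HQ : \forall h \near (0 : R)^', 0 <= t + h -> Q h by exact: HQ.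
    have pos : \forall h \near (0 : R)^', 0 <= t + h.
      near=> h; have : `|h| < t by near: h; exact: dnbhs0_lt.
      by rewrite ltr_norml => /andP[? _]; lra.
    by apply: filterS2 HQ pos => h HQ; exact: HQ.
  apply: cvg_trans (cvg_trans (cvg_app _ W) Hd); apply: near_eq_cvg; near=> h.
  by rewrite /= /shift /= [h%:A]mulr1 (addrC h).
apply: DeriveDef; last exact: cvg_lim Hd.
by apply/cvg_ex; exists (v t).
Unshelve. all: by end_near. Qed.

(** The curve is only given on [0, +oo[. Precomposing it with the absolute value
makes it continuous on the whole line, without changing it on [0, +oo[. *)
Lemma continuous_flow_norm : continuous (fun s : R => theta `|s|).
Proof.
move=> s; set t := `|s|; have t0 : 0 <= t by exact: normr_ge0.
have c0 : theta (t + h)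
    @[h --> within [set h | 0 <= t + h] (0 : R)^'] --> theta t.
  have := flow t0; rewrite /has_derivative_nonneg => Hd.
  have idc : (h : R) @[h --> within [set h | 0 <= t + h] (0 : R)^'] --> (0 : R).
    by move=> Q HQ; apply: cvg_within; apply: cvg_within; exact: HQ.
  have FF : Filter (within [set h | 0 <= t + h] (0 : R)^').
    exact: within_filter.
  have c1 : h *: (h^-1 *: (theta (t + h) - theta t)) + theta t
      @[h --> within [set h | 0 <= t + h] (0 : R)^'] --> 0 *: v t + theta t.
    by apply: cvgD; [exact: cvgZ|exact: cvg_cst].
  rewrite scale0r add0r in c1; apply: cvg_trans c1; apply: near_eq_cvg.
  near=> h.
  have hn0 : h != 0.
    near: h.
    change (\forall h \near (0 : R), h != 0 -> 0 <= t + h -> h != 0).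
    by near=> h' => hn0 _.
  by rewrite scalerA mulfV// scale1r subrK.
apply/cvgrPdist_lt => e e0.
have near0 : \forall h \near (0 : R), h != 0 -> 0 <= t + h ->
    `|theta t - theta (t + h)| < e.
  by move/cvgrPdist_lt: c0 => /(_ e e0).
have nc : `|u| @[u --> s] --> t by exact: norm_continuous.
have : \forall u \near s, (`|u| - t) != 0 -> 0 <= t + (`|u| - t) ->
    `|theta t - theta (t + (`|u| - t))| < e.
  have cc : (`|u| - t) @[u --> s] --> (0 : R).
    by rewrite -(subrr t); apply: cvgB => //; exact: cvg_cst.
  exact: (cc _ near0).
apply: filterS => u; rewrite subrKC => H.
have [ut|ut] := eqVneq (`|u| - t) 0.
  by move/subr0_eq: ut => ->; rewrite subrr normr0.
by apply: H => //; exact: normr_ge0.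
Unshelve. all: by end_near. Qed.

End flow_curve.

(** * Fisher-Rao geometry *)

(** Gibbs' inequality, termwise from ln z <= z - 1 with z = d' x / d x. *)
Lemma DKL_ge0 (R : realType) (X : finType) (d d' : X -> R) :
  simplex d -> simplex d' -> (forall x, 0 < d' x) -> 0 <= DKL d d'.
Proof.
move=> [d0 d1] [_ d1'] d'0.
have <- : \sum_x (d x - d' x) = 0 by rewrite sumrB d1 d1' subrr.
apply: ler_sum => x _.
have [->|dx] := eqVneq (d x) 0; first by rewrite mul0r sub0r oppr_le0 ltW.
have dxp : 0 < d x by rewrite lt_neqAle eq_sym dx d0.
have := @le_ln1Dx R (d' x / d x - 1).
rewrite subrKC => /(_ _) H.
have q0 : 0 < d' x / d x by rewrite divr_gt0.
have {}H : ln (d' x / d x) <= d' x / d x - 1 by apply: H; lra.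
have -> : d x / d' x = (d' x / d x)^-1 by rewrite invf_div.
rewrite lnV ?posrE// mulrN lerNr.
have -> : - (d x - d' x) = d x * (d' x / d x - 1) by field.
by rewrite ler_wpM2l.
Qed.

Section fisher_rao.
Context {R : realType} {X : finType}.
Implicit Types d u v w r : X -> R.

Lemma gFRC d u v : gFR d u v = gFR d v u.
Proof. by apply: eq_bigr => x _; rewrite [u x * _]mulrC. Qed.

Lemma gFRBl d u v w : gFR d (u - v) w = gFR d u w - gFR d v w.
Proof. by rewrite /gFR -sumrB; apply: eq_bigr => x _; rewrite -!mulrBl. Qed.

Lemma gFRBr d u v w : gFR d w (u - v) = gFR d w u - gFR d w v.
Proof. by rewrite gFRC gFRBl !(gFRC d w). Qed.

Lemma gFR_sumr d v n (c : 'I_n -> R) (a : 'I_n -> X -> R) :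
  gFR d v (fun x => \sum_i c i * a i x) = \sum_i c i * gFR d v (a i).
Proof.
rewrite /gFR; under [RHS]eq_bigr do rewrite mulr_sumr.
rewrite [RHS]exchange_big; apply: eq_bigr => x _.
rewrite mulr_sumr mulr_suml; apply: eq_bigr => i _; ring.
Qed.

Lemma gFR_ge0 d v : (forall x, 0 <= d x) -> 0 <= gFR d v v.
Proof.
by move=> d0; apply: sumr_ge0 => x _; rewrite -expr2 divr_ge0 ?sqr_ge0.
Qed.

Lemma normFR_sq d v : (forall x, 0 <= d x) -> normFR d v ^+ 2 = gFR d v v.
Proof. by move=> d0; rewrite sqr_sqrtr ?gFR_ge0. Qed.

(** Pythagoras: if v is a projection of u, the squared norms add up. *)
Lemma gFR_orthogonal d u v : gFR d (u - v) v = 0 ->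
  gFR d u u = gFR d (u - v) (u - v) + gFR d v v.
Proof. by rewrite !gFRBl !gFRBr (gFRC d v u) => /subr0_eq ->; ring. Qed.

Lemma gFR_CauchySchwarz d u v : (forall x, 0 <= d x) ->
  `|gFR d u v| <= normFR d u * normFR d v.
Proof.
move=> d0; rewrite -ler_sqr ?nnegrE ?mulr_ge0 ?sqrtr_ge0//.
rewrite exprMn !normFR_sq// real_normK ?num_real//.
have quad (t : R) : 2 * t * gFR d u v <= gFR d u u + t ^+ 2 * gFR d v v.
  have := gFR_ge0 (fun x => u x - t * v x) d0.
  have -> : gFR d (fun x => u x - t * v x) (fun x => u x - t * v x) =
      gFR d u u - 2 * t * gFR d u v + t ^+ 2 * gFR d v v.
    rewrite /gFR !mulr_sumr -sumrB -big_split /=.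
    by apply: eq_bigr => x _; ring.
  lra.
have := gFR_ge0 u d0; have := gFR_ge0 v d0.
move: (gFR d u u) (gFR d v v) (gFR d u v) quad => a b c quad b0 a0.
have [b00|bn0] := eqVneq b 0.
  have [->|c0] := eqVneq c 0; first by rewrite expr0n mulr_ge0.
  (* In the degenerate case the quadratic inequality reads 2 t c <= a for all t,
     and this t makes its left-hand side a + 1. *)
  have := quad ((a + 1) / (2 * c)); rewrite b00 mulr0 addr0.
  have -> : 2 * ((a + 1) / (2 * c)) * c = a + 1 by field.
  lra.
have bp : 0 < b by rewrite lt_neqAle eq_sym bn0.
have := quad (c / b).
have -> : 2 * (c / b) * c = 2 * (c ^+ 2 / b) by field.
have -> : (c / b) ^+ 2 * b = c ^+ 2 / b by field.
move=> q; rewrite -ler_pdivrMr//; lra.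
Qed.

(** The residual of a least squares minimizer is orthogonal to every regressor,
since moving along a regressor must not decrease the error to first order. *)
Lemma normal_equations n (c b : X -> R) (a : 'I_n -> X -> R) :
  (forall x, 0 <= c x) -> exists w : 'cV[R]_n, forall i,
    \sum_x c x * (b x - \sum_k w k 0 * a k x) * a i x = 0.
Proof.
move=> c0; have [w wmin] := least_squares b a c0.
exists w => i; pose e x := b x - \sum_k w k 0 * a k x.
pose be := \sum_x c x * e x * a i x; pose al := \sum_x c x * a i x ^+ 2.
have al0 : 0 <= al by apply: sumr_ge0 => x _; rewrite mulr_ge0 ?sqr_ge0.
have quad (t : R) : 2 * t * be <= t ^+ 2 * al.
  have := wmin (w + t *: delta_mx i 0).
  have -> : \sum_x c x *
        (b x - \sum_k (w + t *: delta_mx i 0) k 0 * a k x) ^+ 2 =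
      \sum_x c x * e x ^+ 2 - 2 * t * be + t ^+ 2 * al.
    rewrite /be /al !mulr_sumr -sumrB -big_split /=; apply: eq_bigr => x _.
    have -> : \sum_k (w + t *: delta_mx i 0) k 0 * a k x =
        \sum_k w k 0 * a k x + t * a i x.
      under eq_bigr do rewrite !mxE eqxx andbT mulrDl.
      rewrite big_split/=; congr (_ + _).
      rewrite (bigD1 i)//= eqxx mulr1 big1 ?addr0// => k /negbTE ->.
      by rewrite mulr0 mul0r.
    rewrite /e; ring.
  lra.
suff : be = 0 by [].
apply/eqP; rewrite -sqrf_eq0 eq_le sqr_ge0 andbT.
have al1 : 0 < al + 1 by rewrite ltr_wpDl.
(* The optimal step is be / al; adding 1 avoids the case al = 0. *)
have := quad (be / (al + 1)).
have -> : 2 * (be / (al + 1)) * be = 2 * be ^+ 2 / (al + 1).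
  by field; rewrite gt_eqF.
have -> : (be / (al + 1)) ^+ 2 * al = be ^+ 2 * (al / (al + 1)) / (al + 1).
  by field; rewrite gt_eqF.
rewrite ler_pM2r ?invr_gt0//.
have : al / (al + 1) <= 1 by rewrite ler_pdivrMr// mul1r lerDl.
have := sqr_ge0 be; move: (be ^+ 2) (al / (al + 1)) => B q *; nra.
Qed.

Lemma grad_dot r d : grad (dot r) d = r.
Proof.
apply/funext => x; rewrite /grad derive1E.
have -> : (fun h : R => dot r (fun y => d y + h * (y == x)%:R)) =
    (fun h => dot r d + h * r x).
  apply/funext => h; rewrite /dot.
  under eq_bigr do rewrite mulrDr; rewrite big_split/=; congr (_ + _).
  rewrite (bigD1 x)//= eqxx big1 ?addr0 => [|y /negbTE ->]; last first.
    by rewrite !mulr0.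
  by rewrite mulr1 mulrC.
have d1 : is_derive (0 : R) (1 : R) (fun h : R => h * r x) (r x).
  have := is_deriveM (is_derive_id (0 : R) 1) (is_derive_cst (r x) (0 : R) 1).
  by rewrite scaler0 add0r [_ *: 1]mulr1.
have dh := is_deriveD (is_derive_cst (dot r d) (0 : R) 1) d1.
by rewrite (@derive_val _ _ _ _ _ _ _ dh) add0r.
Qed.

(** The vector d r is the Fisher-Rao gradient of d |-> r^T d on the whole positive
orthant. *)
Lemma gFR_mul d r u : (forall x, 0 < d x) ->
  gFR d (fun x => d x * r x) u = dot r u.
Proof. by move=> d0; apply: eq_bigr => x _; field; rewrite gt_eqF. Qed.

(** The gradient along C is the projection of the ambient gradient d r onto the
tangent space. The orthogonal complement of that space is spanned by the vectors
d (a i), so projecting amounts to regressing r on the constraints a i with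
weights d, and the normal equations say that the residual is tangent. *)
Lemma gradFR_dotP (I : finType) (a : I -> X -> R) (C : set (X -> R)) r d :
  tangent C = [set v | forall i, dot v (a i) = 0] -> (forall x, 0 < d x) ->
  tangent C (gradFR C (dot r) d) /\
  forall v, tangent C v -> gFR d (gradFR C (dot r) d) v = dot r v.
Proof.
move=> TE d0; rewrite /gradFR grad_dot.
apply: (@xgetPex _ 0 [set u | tangent C u /\
  forall v, tangent C v -> gFR d u v = dot r v]); rewrite TE.
have [|w wN] := @normal_equations #|I| d r (fun i => a (enum_val i)).
  by move=> x; exact: ltW.
pose l x := \sum_k w k 0 * a (enum_val k) x.
exists (fun x => d x * (r x - l x)); split=> /= [i|v vT].
  rewrite /dot -[RHS](wN (enum_rank i)); apply: eq_bigr => x _.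
  by rewrite enum_rankK.
have -> : gFR d (fun x => d x * (r x - l x)) v = dot r v - dot v l.
  rewrite /dot -sumrB; apply: eq_bigr => x _; field.
  by rewrite gt_eqF.
rewrite -[RHS]subr0; congr (_ - _); rewrite /dot /l.
under eq_bigr do rewrite mulr_sumr; rewrite exchange_big big1// => k _.
transitivity (w k 0 * dot v (a (enum_val k))); last by rewrite vT mulr0.
by rewrite /dot mulr_sumr; apply: eq_bigr => x _; rewrite mulrCA.
Qed.

(** When g - v is tangent, it is the projection of d r - v onto the tangent space,
and the right-hand side is the squared norm of d r - v. *)
Lemma gradFR_dist_le (C : set (X -> R)) r d v
    (g := gradFR C (dot r) d) :
  (forall x, 0 < d x) ->
  (forall u, tangent C u -> gFR d g u = dot r u) -> tangent C (g - v) ->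
  gFR d (g - v) (g - v) <= \sum_x d x * (v x / d x - r x) ^+ 2.
Proof.
move=> d0 gP gvT.
pose dr x := d x * r x.
have drE u : gFR d dr u = dot r u by exact: gFR_mul.
have ort : gFR d ((dr - v) - (g - v)) (g - v) = 0.
  have -> : (dr - v) - (g - v) = dr - g by rewrite opprB addrA subrK.
  by rewrite gFRBl drE gP// subrr.
have -> : \sum_x d x * (v x / d x - r x) ^+ 2 = gFR d (dr - v) (dr - v).
  apply: eq_bigr => x _.
  transitivity ((d x * r x - v x) ^+ 2 / d x); last by [].
  by field; rewrite gt_eqF.
rewrite (gFR_orthogonal ort) lerDr gFR_ge0// => x; exact: ltW.
Qed.

End fisher_rao.

Section parametrized_fisher_rao.
Context {R : realType} {X : finType} {p : nat}.
Variables (D : 'cV[R]_p -> X -> R) (th : 'cV[R]_p).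
Hypothesis D_gt0 : forall x, 0 < D th x.
Implicit Types (u : X -> R) (w : 'cV[R]_p).

Let D_ge0 x : 0 <= D th x. Proof. exact: ltW. Qed.

Lemma gFR_wnabla u w :
  gFR (D th) u (wnabla D th w) = \sum_i w i 0 * gFR (D th) u (partial D th i).
Proof. exact: gFR_sumr. Qed.

Lemma wnablaB w w' : wnabla D th w - wnabla D th w' = wnabla D th (w - w').
Proof.
apply/funext => x.
transitivity (wnabla D th w x - wnabla D th w' x); first by [].
rewrite /wnabla -sumrB; apply: eq_bigr => i _.
by rewrite !mxE mulrBl.
Qed.

Lemma gram_mulmxE w i :
  (gram D th *m w) i 0 = gFR (D th) (partial D th i) (wnabla D th w).
Proof. by rewrite gFR_wnabla mxE; apply: eq_bigr => j _; rewrite mxE mulrC. Qed.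

(** The normal equations G v = b of projecting u onto the span of the partial
derivatives are solvable, so b is in the range of G, and G G^+ fixes that range:
G^+ b solves them as well. *)
Lemma moore_penrose_projection u i
    (w := moore_penrose (gram D th) *m
            \col_i gFR (D th) u (partial D th i)) :
  gFR (D th) (u - wnabla D th w) (partial D th i) = 0.
Proof.
have [|v vN] := @normal_equations _ _ p (fun x => (D th x)^-1) u (partial D th).
  by move=> x; rewrite invr_ge0.
have GV : gram D th *m v = \col_i gFR (D th) u (partial D th i).
  apply/colP => j; rewrite gram_mulmxE mxE gFRC; apply/eqP.
  rewrite eq_sym -subr_eq0 -gFRBl -(vN j); apply/eqP; apply: eq_bigr => x _.
  by rewrite [LHS]mulrC mulrA.
have GW : gram D th *m w = \col_i gFR (D th) u (partial D th i).
  rewrite /w -GV !mulmxA.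
  by have [-> _ _ _] := moore_penroseP (gram D th).
rewrite gFRBl (gFRC _ (wnabla _ _ _)) -gram_mulmxE GW mxE.
by rewrite subrr.
Qed.

(** By Pythagoras no other candidate is closer to g. *)
Lemma eps2_projection C f w (g := gradFR C f (D th)) :
  (forall i, gFR (D th) (g - wnabla D th w) (partial D th i) = 0) ->
  eps2 D C f th = gFR (D th) (g - wnabla D th w) (g - wnabla D th w).
Proof.
move=> ort; rewrite -normFR_sq//; apply: inf_minimizer => w'.
rewrite !normFR_sq// -/g.
have uE : g - wnabla D th w = g - wnabla D th w' - wnabla D th (w - w').
  by rewrite -wnablaB opprB addrA subrK.
rewrite (@gFR_orthogonal _ _ _ (g - wnabla D th w') (wnabla D th (w - w'))) -uE.
  by rewrite lerDl gFR_ge0.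
by rewrite gFR_wnabla big1// => i _; rewrite ort mulr0.
Qed.

End parametrized_fisher_rao.

(** * Fisher-Rao natural gradient flows on a polytope of distributions *)

Lemma tangentB (R : realType) (X : finType) (C : set (X -> R)) (u v : X -> R) :
  C u -> C v -> tangent C (u - v).
Proof.
have hull w : C w -> affine_hull C w.
  move=> Cw; exists 1%N, (fun=> 1), (fun=> w); split=> //.
    by rewrite big_ord1.
  by rewrite big_ord1 scale1r.
by move=> Cu Cv; exists u, v; split=> //; exact: hull.
Qed.

(** In this section D parametrizes positive points of a set C of probability
vectors whose tangent space is cut out by finitely many linear equations, [g] is
the Fisher-Rao gradient of the linear reward, [w] the velocity of the flow in
parameter space and [v] its image, the velocity of the distributions. *)
Section natural_gradient_flow.
Context {R : realType} {X I : finType} {p : nat}.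
Variables (C : set (X -> R)) (a : I -> X -> R) (r : X -> R).
Variables (D : 'cV[R]_p -> X -> R) (theta : R -> 'cV[R]_p).
Hypothesis C_simplex : forall d, C d -> simplex d.
Hypothesis C_tangent : tangent C = [set v | forall i, dot v (a i) = 0].
Hypothesis D_C : forall th, C (D th).
Hypothesis D_gt0 : forall th x, 0 < D th x.
Hypothesis D_diff : forall th x, differentiable (D ^~ x) th.
Hypothesis flow : forall t : R, 0 <= t -> has_derivative_nonneg theta t
  (moore_penrose (gram D (theta t)) *m
     nabla (fun th => dot r (D th)) (theta t)).

Let D_ge0 th x : 0 <= D th x. Proof. exact: ltW. Qed.
Let g th := gradFR C (dot r) (D th).
Let w th := moore_penrose (gram D th) *m nabla (fun th' => dot r (D th')) th.
Let v th := wnabla D th (w th).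

Lemma dot_wnabla (c : X -> R) th w' :
  dot c (wnabla D th w') = \sum_i w' i 0 * dot c (partial D th i).
Proof.
rewrite /dot; under [RHS]eq_bigr do rewrite mulr_sumr.
rewrite [RHS]exchange_big; apply: eq_bigr => x _; rewrite mulr_sumr.
by apply: eq_bigr => i _; rewrite mulrCA.
Qed.

(** Partial derivatives inherit every linear equation satisfied by D. *)
Lemma dot_partial_cst (c : X -> R) k th i :
  (forall th', dot c (D th') = k) -> dot c (partial D th i) = 0.
Proof.
move=> ck; rewrite -nabla_dot//.
rewrite (_ : (fun th' => dot c (D th')) = cst k); last exact/funext.
by rewrite mxE derive_cst.
Qed.

Lemma wnabla_tangent th w' : tangent C (wnabla D th w').
Proof.
have dotC (u u' : X -> R) : dot u u' = dot u' u.
  by apply: eq_bigr => x _; rewrite mulrC.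
rewrite C_tangent => j; rewrite dotC dot_wnabla big1// => i _.
rewrite (@dot_partial_cst _ (dot (a j) (D th))) ?mulr0// => th'.
have := tangentB (D_C th') (D_C th); rewrite C_tangent => /(_ j).
have -> : dot (D th' - D th) (a j) = dot (D th') (a j) - dot (D th) (a j).
  by rewrite /dot -sumrB; apply: eq_bigr => x _; rewrite -mulrBl.
by rewrite !(dotC (D _)) => /subr0_eq.
Qed.

Lemma sum_wnabla th w' : \sum_x wnabla D th w' x = 0.
Proof.
have -> : \sum_x wnabla D th w' x = dot (cst 1) (wnabla D th w').
  by apply: eq_bigr => x _; rewrite /= mul1r.
rewrite dot_wnabla big1// => i _.
rewrite (@dot_partial_cst _ 1) ?mulr0// => th'.
rewrite -[RHS](C_simplex (D_C th')).2 /dot; apply: eq_bigr => x _.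
by rewrite /= mul1r.
Qed.

Lemma gradFR_tangent th : tangent C (g th).
Proof. by have [] := gradFR_dotP r C_tangent (D_gt0 th). Qed.

Lemma gFR_gradFR th u : tangent C u -> gFR (D th) (g th) u = dot r u.
Proof. by have [_] := gradFR_dotP r C_tangent (D_gt0 th); apply. Qed.

Lemma tangent_sub u u' : tangent C u -> tangent C u' -> tangent C (u - u').
Proof.
rewrite C_tangent => uT u'T i; rewrite -(subrr 0) -{1}(uT i) -(u'T i).
by rewrite /dot -sumrB; apply: eq_bigr => x _; rewrite -mulrBl.
Qed.

Lemma eps2_le_compatible_error th :
  eps2 D C (dot r) th <= compatible_error D r th.
Proof.
have [w' ->] := compatible_error_attained r (D_ge0 th).
pose e := g th - wnabla D th w'.
apply: (@le_trans _ _ (gFR (D th) e e)).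
  rewrite -normFR_sq//; apply: ge_inf; last by exists w'.
  by exists 0 => _ [u _ <-]; exact: sqr_ge0.
apply: le_trans (gradFR_dist_le (D_gt0 th) _ _) _.
- exact: gFR_gradFR.
- by apply: tangent_sub; [exact: gradFR_tangent|exact: wnabla_tangent].
rewrite /expect le_eqVlt; apply/orP; left; apply/eqP; apply: eq_bigr => x _.
congr (_ * (_ - _) ^+ 2); rewrite /wnabla mulr_suml; apply: eq_bigr => i _.
by rewrite /partial nabla_ln// mulrA.
Qed.

(** The gradient of the reward in the parameters is the family of inner products
of [g] with the partial derivatives, so [w] is the solution of the normal
equations provided by the pseudo-inverse. *)
Lemma velocity_orthogonal th i : gFR (D th) (g th - v th) (partial D th i) = 0.
Proof.
rewrite /v /w.
have -> : nabla (fun th' => dot r (D th')) th =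
    \col_i gFR (D th) (g th) (partial D th i).
  apply/colP => j; rewrite nabla_dot// [RHS]mxE gFR_gradFR//.
  have -> : partial D th j = wnabla D th (delta_mx j 0).
    apply/funext => x; rewrite /wnabla (bigD1 j)//= mxE !eqxx mul1r.
    by rewrite big1 ?addr0// => k /negbTE kj; rewrite mxE kj mul0r.
  exact: wnabla_tangent.
exact: moore_penrose_projection.
Qed.

Lemma gFR_velocity_orthogonal th : gFR (D th) (g th - v th) (v th) = 0.
Proof.
by rewrite gFR_wnabla big1// => i _; rewrite velocity_orthogonal mulr0.
Qed.

Lemma eps2_velocity th :
  Num.sqrt (eps2 D C (dot r) th) = normFR (D th) (g th - v th).
Proof. by rewrite (eps2_projection (D_gt0 th) (@velocity_orthogonal th)). Qed.

Lemma gFR_velocity_reward th : dot r (v th) = gFR (D th) (v th) (v th).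
Proof.
rewrite -(@gFR_gradFR th _ (wnabla_tangent th (w th))).
by apply/subr0_eq; rewrite -gFRBl gFR_velocity_orthogonal.
Qed.

(** Both projecting [D th * r] to [g th] and [g th] to [v th] decrease the norm,
and [D th] is bounded by 1. This makes the divergence to a fixed distribution
Lipschitz along the flow. *)
Lemma gFR_velocity_bound th : gFR (D th) (v th) (v th) <= \sum_x r x ^+ 2.
Proof.
have gT := gradFR_tangent th.
have h1 : gFR (D th) (v th) (v th) <= gFR (D th) (g th) (g th).
  by rewrite (gFR_orthogonal (gFR_velocity_orthogonal th)) lerDr gFR_ge0.
pose dr x := D th x * r x.
have drE u : gFR (D th) dr u = dot r u by exact: gFR_mul.
have ort : gFR (D th) (dr - g th) (g th) = 0.
  by rewrite gFRBl drE gFR_gradFR// subrr.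
apply: (le_trans h1); apply: (@le_trans _ _ (gFR (D th) dr dr)).
  by rewrite (gFR_orthogonal ort) lerDr gFR_ge0.
rewrite drE /dot; apply: ler_sum => x _; rewrite /dr mulrCA -expr2.
rewrite ler_piMl ?sqr_ge0//.
have [_ <-] := C_simplex (D_C th).
by rewrite (bigD1 x)//= lerDl sumr_ge0.
Qed.

Lemma is_derive_flow_comp (F : 'cV[R]_p -> R) (s : R) :
  0 < s -> differentiable F (theta s) ->
  is_derive s (1 : R) (fun u => F (theta `|u|))
    (\sum_i w (theta s) i 0 * nabla F (theta s) i 0).
Proof.
move=> s0 dF.
have := is_derive_along_curve dF (is_derive_flow flow s0).
apply: near_eq_is_derive; near=> u; rewrite /= gtr0_norm//.
by near: u; exact: lt_nbhsr.
Unshelve. all: by end_near. Qed.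

Lemma continuous_flow_comp (F : 'cV[R]_p -> R) :
  (forall th, differentiable F th) -> continuous (fun u : R => F (theta `|u|)).
Proof.
move=> dF u.
apply: (@continuous_comp _ _ _ (fun u : R => theta `|u|) F).
  exact: (continuous_flow_norm flow).
exact: differentiable_continuous.
Qed.

Lemma differentiable_reward th : differentiable (fun th' => dot r (D th')) th.
Proof.
apply: differentiable_bigsum => x; exact: differentiableM.
Qed.

(** The derivative of the reward along the flow is the squared norm of the
velocity. *)
Lemma reward_nondecreasing (s t : R) : 0 <= s -> s <= t ->
  dot r (D (theta s)) <= dot r (D (theta t)).
Proof.
move=> s0; rewrite le_eqVlt => /predU1P[->//|st].
pose H (u : R) := dot r (D (theta `|u|)).
have t0 : 0 <= t by lra.
have cH := continuous_flow_comp differentiable_reward.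
pose H' u := gFR (D (theta u)) (v (theta u)) (v (theta u)).
have [|c cst E] := @MVT R H H' s t st _ (@continuous_subspaceT _ _ _ _ cH).
  move=> u; rewrite in_itv/= => /andP[su _].
  rewrite /H' -gFR_velocity_reward dot_wnabla.
  under eq_bigr do rewrite -nabla_dot//.
  by apply: is_derive_flow_comp; [lra|exact: differentiable_reward].
rewrite -subr_ge0; move: E; rewrite /H (ger0_norm s0) (ger0_norm t0) => ->.
by rewrite mulr_ge0 ?gFR_ge0// subr_ge0 ltW.
Qed.

Variable dstar : X -> R.
Hypothesis dstar_C : C dstar.

Let dstar_ge0 x : 0 <= dstar x. Proof. exact: (C_simplex dstar_C).1. Qed.

Lemma chi2_normFR th :
  Num.sqrt (chi2 dstar (D th)) = normFR (D th) (dstar - D th).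
Proof.
congr Num.sqrt; apply: eq_bigr => x _.
transitivity ((dstar x - D th x) * (dstar x - D th x) / D th x); last by [].
by field; rewrite gt_eqF.
Qed.

Lemma differentiable_ln_param th x :
  differentiable (fun th' => ln (D th' x)) th.
Proof.
apply: (@differentiable_comp _ _ _ _ (D ^~ x) (@ln R)); first exact: D_diff.
by apply/derivable1_diffP; have [] := is_derive1_ln (D_gt0 th x).
Qed.

Lemma DKL_split th :
  DKL dstar (D th) =
  \sum_x dstar x * ln (dstar x) - \sum_x dstar x * ln (D th x).
Proof.
rewrite /DKL -sumrB; apply: eq_bigr => x _.
have [->|dx] := eqVneq (dstar x) 0; first by rewrite !mul0r subr0.
have dp : 0 < dstar x by rewrite lt_neqAle eq_sym dx dstar_ge0.
by rewrite lnM ?posrE ?invr_gt0// lnV ?posrE// mulrDr mulrN.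
Qed.

(** Differentiating - sum_x dstar(x) ln D(x) gives - sum_x dstar(x) v(x) / D(x).
Replacing dstar by dstar - D changes nothing because the velocity sums to
zero. *)
Lemma is_derive_DKL_flow (s : R) : 0 < s ->
  is_derive s (1 : R) (fun u => DKL dstar (D (theta `|u|)))
    (- gFR (D (theta s)) (dstar - D (theta s)) (v (theta s))).
Proof.
move=> s0; under eq_fun do rewrite DKL_split.
have dl x : is_derive s (1 : R) (fun u => dstar x * ln (D (theta `|u|) x))
    (dstar x * (v (theta s) x / D (theta s) x)).
  have := is_derive_flow_comp s0 (differentiable_ln_param (theta s) x).
  rewrite (_ : \sum_i _ = v (theta s) x / D (theta s) x); last first.
    rewrite /v /wnabla mulr_suml; apply: eq_bigr => i _.
    by rewrite nabla_ln// mulrA mxE.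
  by move=> dlx; exact: (is_deriveZ (dstar x) dlx).
have := is_deriveB (is_derive_cst (\sum_x dstar x * ln (dstar x)) s (1 : R))
  (is_derive_bigsum (index_enum X) dl).
rewrite sub0r; congr (is_derive _ _ _ (- _)).
rewrite gFRBl [X in _ = _ - X](_ : _ = 0) ?subr0.
  by apply: eq_bigr => x _; rewrite mulrA.
rewrite -(sum_wnabla (theta s) (w (theta s))); apply: eq_bigr => x _.
by rewrite mulrAC mulfV ?mul1r// gt_eqF.
Qed.

Lemma continuous_DKL_flow :
  continuous (fun u : R => DKL dstar (D (theta `|u|))).
Proof.
apply: (@continuous_flow_comp (fun th => DKL dstar (D th))) => th.
under eq_fun do rewrite DKL_split.
apply: differentiableB => //; apply: differentiable_bigsum => x.
apply: differentiableM => //; exact: differentiable_ln_param.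
Qed.

Lemma chi2_flow_bounded (t : R) : 0 < t ->
  exists B, forall s, 0 < s < t ->
    normFR (D (theta s)) (dstar - D (theta s)) <= B.
Proof.
move=> t0; pose c (u : R) := chi2 dstar (D (theta `|u|)).
have cc : continuous c.
  apply: (@continuous_flow_comp (fun th => chi2 dstar (D th))) => th.
  rewrite /chi2 /expect; apply: differentiable_bigsum => x.
  apply: differentiableM => //; apply: differentiableM.
    under eq_fun do rewrite expr2.
    by apply: differentiableM; apply: differentiableB.
  apply: (@differentiable_comp _ _ _ _ (fun th => D th x ^+ 2) GRing.inv).
    by under eq_fun do rewrite expr2; exact: differentiableM.
  by apply: differentiable_Rinv; rewrite expf_neq0// gt_eqF.
have [m _ cm] := EVT_max (ltW t0) (@continuous_subspaceT _ _ _ _ cc).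
exists (Num.sqrt (c m)) => s /andP[s0 st].
rewrite -chi2_normFR ler_sqrt.
  have := cm s; rewrite /c (gtr0_norm s0) in_itv/= (ltW s0) (ltW st).
  exact.
by apply: sumr_ge0 => x _; rewrite mulr_ge0// divr_ge0 ?sqr_ge0.
Qed.

(** The left-hand side is the time derivative of the divergence plus the gap at
the final time t, which is at most the gap at time s by monotonicity. The gap at
time s is the inner product of dstar - D with the gradient [g], so what remains
is the inner product of dstar - D with g - v. *)
Lemma suboptimality_le (s t : R) : 0 <= s -> s <= t ->
  - gFR (D (theta s)) (dstar - D (theta s)) (v (theta s)) +
    (dot r dstar - dot r (D (theta t))) <=
  Num.sqrt (chi2 dstar (D (theta s))) * Num.sqrt (eps2 D C (dot r) (theta s)).
Proof.
move=> s0 st; rewrite chi2_normFR eps2_velocity.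
set th := theta s; set u := dstar - D th.
have uT : tangent C u by exact: tangentB.
have := gFR_CauchySchwarz u (g th - v th) (D_ge0 th).
apply: le_trans; apply: le_trans (ler_norm _).
rewrite gFRBr (gFRC _ u (g th)) gFR_gradFR//.
have -> : dot r u = dot r dstar - dot r (D th).
  by rewrite /dot -sumrB; apply: eq_bigr => x _; rewrite -mulrBr.
have := reward_nondecreasing s0 st; rewrite -/th; lra.
Qed.

Theorem natural_gradient_flow_bound (t : R) : 0 < t ->
  ((dot r dstar - dot r (D (theta t)))%:E <=
    (DKL dstar (D (theta 0)) / t)%:E + (t^-1)%:E *
      \int[lebesgue_measure]_(s in `[0%R, t])
        (Num.sqrt (chi2 dstar (D (theta s))) *
         Num.sqrt (eps2 D C (dot r) (theta s)))%:E)%E.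
Proof.
move=> t0; set k := dot r dstar - _.
pose G (s : R) := Num.sqrt (chi2 dstar (D (theta s))) *
  Num.sqrt (eps2 D C (dot r) (theta s)).
change (k%:E <= (DKL dstar (D (theta 0)) / t)%:E + (t^-1)%:E *
  \int[lebesgue_measure]_(s in `[0%R, t]) (G s)%:E)%E.
(* Using the constant gap k at time t instead of the integral of the gaps makes
   the increment of F explicit. *)
pose F (u : R) := DKL dstar (D (theta `|u|)) + u * k.
pose f (s : R) := - gFR (D (theta s)) (dstar - D (theta s)) (v (theta s)) + k.
have cF : continuous F.
  move=> u; apply: cvgD; first exact: continuous_DKL_flow.
  by apply: cvgM; [exact: cvg_id|exact: cvg_cst].
have dF s : 0 < s < t -> is_derive s (1 : R) F (f s).
  move=> /andP[s0 _].
  have d1 : is_derive s (1 : R) (fun h : R => h * k) k.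
    have := is_deriveM (is_derive_id s 1) (is_derive_cst k s 1).
    by rewrite scaler0 add0r [_ *: 1]mulr1.
  exact: is_deriveD (is_derive_DKL_flow s0) d1.
have [B HB] := chi2_flow_bounded t0.
have fM s : 0 < s < t -> `|f s| <= B * Num.sqrt (\sum_x r x ^+ 2) + `|k|.
  move=> st; apply: le_trans (ler_normD _ _) _; rewrite lerD2r normrN.
  apply: le_trans (gFR_CauchySchwarz _ _ (D_ge0 _)) _.
  apply: ler_pM => //; [exact: sqrtr_ge0|exact: sqrtr_ge0|exact: HB|].
  rewrite ler_sqrt; first exact: gFR_velocity_bound.
  by apply: sumr_ge0 => x _; exact: sqr_ge0.
have fG s : 0 < s < t -> f s <= G s.
  by move=> /andP[s0 st]; apply: suboptimality_le; exact: ltW.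
have G0 s : 0 <= G s by rewrite mulr_ge0 ?sqrtr_ge0.
have := increment_le_lower_integral t0 cF dF fM fG G0.
have phi0 : 0 <= DKL dstar (D (theta `|t|)).
  exact: DKL_ge0 (C_simplex dstar_C) (C_simplex (D_C _)) (D_gt0 _).
rewrite /F mul0r addr0 normr0.
have : (0 <= \int[lebesgue_measure]_(s in `[0%R, t]) (G s)%:E)%E.
  by apply: integral_ge0 => s _; rewrite lee_fin.
move: (\int[lebesgue_measure]_(s in `[0%R, t]) (G s)%:E)%E => [J|_ _|//].
  rewrite !lee_fin => _ h.
  rewrite [_^-1 * _]mulrC -mulrDl ler_pdivlMr//.
  rewrite [k * t]mulrC; lra.
by rewrite gt0_muley ?lte_fin ?invr_gt0// addey// leey.
Qed.

End natural_gradient_flow.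

(** * The discounted law of a Markov decision process *)

Section occupancy_measure.
Context {R : realType} {S A : finType}.
Variables (P : S -> A -> S -> R) (mu : S -> R) (gamma : R).
Hypothesis P_kernel : forall s a, simplex (P s a).
Hypothesis mu_simplex : simplex mu.
Hypothesis gamma_range : 0 <= gamma < 1.
Implicit Types (pi d v : S * A -> R) (s : S) (a : A).

Lemma sum_state_action (F : S * A -> R) : \sum_y F y = \sum_s \sum_a F (s, a).
Proof. by rewrite pair_bigA; apply: eq_bigr => -[]. Qed.

Lemma policy_sum pi (F : S -> R) : policy pi ->
  \sum_y pi y * F y.1 = \sum_s F s.
Proof.
move=> pip; rewrite sum_state_action; apply: eq_bigr => s _.
by rewrite /= -mulr_suml (pip s).2 mul1r.
Qed.

Lemma kernel_sum (F : S * A -> R) :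
  \sum_s \sum_y F y * P y.1 y.2 s = \sum_y F y.
Proof.
rewrite exchange_big; apply: eq_bigr => y _.
by rewrite -mulr_sumr (P_kernel y.1 y.2).2 mulr1.
Qed.

(** The l^1-norm of v is at most gamma times itself, because a policy and the
transition kernel preserve total mass. *)
Lemma stationary_eq0 pi v : policy pi ->
  (forall y, v y = pi y * (gamma * \sum_z v z * P z.1 z.2 y.1)) ->
  forall y, v y = 0.
Proof.
move=> pip vE.
have [g0 g1] := andP gamma_range.
have le1 : \sum_y `|v y| <= gamma * \sum_y `|v y|.
  rewrite -{2}kernel_sum -(policy_sum _ pip) mulr_sumr; apply: ler_sum => y _.
  have py : 0 <= pi y by case: y => s a; apply: (pip s).1.
  rewrite {1}vE !normrM (ger0_norm py) (ger0_norm g0) mulrCA.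
  rewrite ler_wpM2l// ler_wpM2l//; apply: le_trans (ler_norm_sum _ _ _) _.
  by apply: ler_sum => z _; rewrite normrM (ger0_norm ((P_kernel z.1 z.2).1 _)).
have : \sum_y `|v y| <= 0.
  have g1' : 0 < 1 - gamma by rewrite subr_gt0.
  by rewrite -(pmulr_rle0 _ g1') mulrBl mul1r subr_le0.
move=> v0 y; apply/eqP; rewrite -normr_le0; apply: le_trans v0.
by rewrite (bigD1 y)//= lerDl sumr_ge0.
Qed.

Fixpoint state_action_law pi n : S * A -> R :=
  if n is n'.+1 then
    fun y => pi y * \sum_z state_action_law pi n' z * P z.1 z.2 y.1
  else fun y => pi y * mu y.1.

Lemma state_action_law_simplex pi n :
  policy pi -> simplex (state_action_law pi n).
Proof.
move=> pip; have pi0 y : 0 <= pi y by case: y => s a; apply: (pip s).1.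
elim: n => [|n [IH0 IH1]]; split => /= [y|].
- by rewrite mulr_ge0// mu_simplex.1.
- by rewrite policy_sum// mu_simplex.2.
- rewrite mulr_ge0// sumr_ge0// => z _.
  by rewrite mulr_ge0// (P_kernel z.1 z.2).1.
- by rewrite (policy_sum (fun s => \sum_z _ z * P z.1 z.2 s))// kernel_sum.
Qed.

Definition discounted_law pi y : R :=
  limn (series (fun n => gamma ^+ n * state_action_law pi n y)).

Lemma cvg_discounted_law pi y : policy pi ->
  series (fun n => gamma ^+ n * state_action_law pi n y) @ \oo
    --> discounted_law pi y.
Proof.
move=> pip; have [g0 g1] := andP gamma_range.
apply: (@series_le_cvg _ _ (geometric 1 gamma)) => [n|n|n|].
- by rewrite mulr_ge0 ?exprn_ge0// (state_action_law_simplex n pip).1.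
- by rewrite /= mul1r exprn_ge0.
- rewrite /= mul1r ler_piMr ?exprn_ge0//.
  have [l0 <-] := state_action_law_simplex n pip.
  by rewrite (bigD1 y)//= lerDl sumr_ge0.
- by apply: is_cvg_geometric_series; rewrite ger0_norm.
Qed.

(** Shifting the series by one step turns the recursion defining the law at each
time into a fixed-point equation for partial sums, which passes to the limit. *)
Lemma discounted_lawE pi y : policy pi ->
  discounted_law pi y =
  pi y * (mu y.1 + gamma * \sum_z discounted_law pi z * P z.1 z.2 y.1).
Proof.
move=> pip.
pose Z z := series (fun n => gamma ^+ n * state_action_law pi n z).
have ZS n : Z y n.+1 = pi y * (mu y.1 + gamma * \sum_z Z z n * P z.1 z.2 y.1).
  rewrite /Z /series/= big_nat_recl//= expr0 mul1r mulrDr; congr (_ + _).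
  under [in RHS]eq_bigr do rewrite mulr_suml.
  rewrite exchange_big !mulr_sumr; apply: eq_bigr => i _.
  rewrite exprS mulrCA -!mulrA; congr (_ * (_ * _)).
  by rewrite mulr_sumr; apply: eq_bigr => z _; rewrite mulrA.
have lhs : Z y n.+1 @[n --> \oo] --> discounted_law pi y.
  by rewrite cvg_shiftS; exact: cvg_discounted_law.
apply: cvg_unique lhs _ => //; rewrite (funext ZS).
apply: cvgM; first exact: cvg_cst.
apply: cvgD; first exact: cvg_cst.
apply: cvgM; first exact: cvg_cst.
apply: cvg_big => [|z _]; first by apply: add_continuous.
by apply: cvgM; [exact: cvg_discounted_law|exact: cvg_cst].
Qed.

Lemma discounted_law_ge0 pi y : policy pi -> 0 <= discounted_law pi y.
Proof.
move=> pip; apply: limr_ge; first exact: cvg_discounted_law.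
apply: nearW => n; apply: sumr_ge0 => i _.
rewrite mulr_ge0 ?exprn_ge0 ?(andP gamma_range).1//.
by rewrite (state_action_law_simplex i pip).1.
Qed.

End occupancy_measure.

(** * From the process to the discounted law *)

Section finite_valued.
Context {d : measure_display} {T : measurableType d}.
Context {R : realType} {X : finType}.
Variables (Pr : probability T R) (f : T -> X).
Hypothesis mf : forall x, measurable [set w | f w = x].

(** A finite-valued random variable splits every event, which is how
coordinates of the process are marginalized. *)
Lemma measure_partition (B : set T) : measurable B ->
  Pr B = (\sum_x Pr (B `&` [set w | f w = x]))%E.
Proof.
move=> mB; rewrite fsbig_seq ?index_enum_uniq// -measure_fin_bigcup.
- congr (Pr _); apply/seteqP; split=> [w Bw|w [x _ []]//].
  by exists (f w) => //=; rewrite mem_index_enum.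
- exact: finite_finset.
- apply/trivIsetP => x y _ _ xy; apply/seteqP; split=> // w [[_ fx] [_ fy]].
  by move: xy; rewrite -fx -fy eqxx.
- by move=> x _; exact: measurableI.
Qed.

Lemma finite_valuedE (g : X -> R) w :
  g (f w) = \sum_x g x * \1_[set w' | f w' = x] w.
Proof.
rewrite (bigD1 (f w))//= indicE mem_set// mulr1 big1 ?addr0// => x xf.
by rewrite indicE memNset ?mulr0//= => fx; rewrite fx eqxx in xf.
Qed.

Lemma measurable_finite_valued (g : X -> R) : measurable_fun setT (g \o f).
Proof.
rewrite (_ : g \o f = fun w => \sum_x g x * \1_[set w' | f w' = x] w);
  last first.
  by apply/funext => w; exact: finite_valuedE.
apply: measurable_sum => x; exact: measurable_funM.
Qed.

Lemma integral_finite_valued (g : X -> R) :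
  (\int[Pr]_w (g (f w))%:E =
   (\sum_x g x * fine (Pr [set w | f w = x]))%:E)%E.
Proof.
under eq_integral do rewrite finite_valuedE -sumEFin.
under eq_integral do under eq_bigr do rewrite EFinM.
have i1 x : Pr.-integrable setT (fun w => (\1_[set w' | f w' = x] w)%:E).
  exact: integrable_indic.
rewrite integral_sum//; last first.
  by move=> x; exact: integrableZl.
rewrite -sumEFin; apply: eq_bigr => x _; rewrite integralZl// integral_indic//.
by rewrite setIT EFinM fineK// fin_num_measure.
Qed.

End finite_valued.

Section mdp_process.
Context {R : realType} {S A : finType}.
Variables (P : S -> A -> S -> R) (mu : S -> R) (gamma : R).
Hypothesis P_kernel : forall s a, simplex (P s a).
Hypothesis mu_simplex : simplex mu.
Hypothesis gamma_range : 0 <= gamma < 1.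
Context {dsp : measure_display} {Omega : measurableType dsp}.
Variables (St : nat -> Omega -> S) (At : nat -> Omega -> A).
Variables (pi : S * A -> R) (Pr : probability Omega R).
Hypothesis pip : policy pi.
Hypothesis law : is_mdp_law St At P mu pi Pr.

Let SA t w := (St t w, At t w).

Lemma measurable_state_action t x : measurable [set w | SA t w = x].
Proof.
have [mS mA _] := law.
rewrite (_ : [set w | _] = [set w | St t w = x.1] `&` [set w | At t w = x.2]).
  exact: measurableI.
case: x => s a; apply/seteqP; split=> w /=; first by case=> <- <-.
by case=> <- <-.
Qed.

(** Laws of stretches of the trajectory are easier to marginalize than paths from
time 0: removing the first pair of a window yields a shorter window. *)
Let window k n (x : nat -> S * A) :=
  [set w | forall t, (k <= t <= n)%N -> SA t w = x t].

Lemma measurable_window k n x : measurable (window k n x).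
Proof.
rewrite (_ : window k n x =
    \bigcap_t [set w | (k <= t <= n)%N -> SA t w = x t]); last first.
  by apply/seteqP; split=> w /= wx t; [move=> _; exact: wx|exact: wx].
apply: bigcapT_measurable => t; case: (boolP (k <= t <= n)%N) => tkn.
  rewrite (_ : [set w | _] = [set w | SA t w = x t]).
    exact: measurable_state_action.
  by apply/seteqP; split=> w /=; [exact|].
by rewrite (_ : [set w | _] = setT) //; apply/seteqP; split.
Qed.

(** By induction on the start k of the window: summing over the pair at time k
is one step of the recursion of [state_action_law]. The base case is the given law
of finite paths. *)
Lemma window_law k n x : (k <= n)%N ->
  Pr (window k n x) = (state_action_law P mu pi k (x k) *
    \prod_(k <= t < n) (P (x t).1 (x t).2 (x t.+1).1 * pi (x t.+1)))%:E.
Proof.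
have [_ _ joint] := law.
elim: k x => [|k IH] x kn.
  rewrite (_ : window 0 n x = [set w | forall t, (t <= n)%N ->
      St t w = (x t).1 /\ At t w = (x t).2]); last first.
    apply/seteqP; split=> w /= wx t tn; last first.
      by have [] := wx t tn; rewrite /SA => -> ->; case: (x t).
    by rewrite -(wx t tn).
  rewrite (joint n (fst \o x) (snd \o x)) /=; congr EFin.
  rewrite big_split/= big_mkord big_mkord big_ord_recl/=.
  rewrite -!surjective_pairing.
  under eq_bigr do rewrite -surjective_pairing.
  by rewrite mulrA [mu _ * _]mulrC -!mulrA; congr (_ * (_ * _)); rewrite mulrC.
rewrite (measure_partition _ (measurable_state_action k)
  (measurable_window k.+1 n x)).
pose x' y t := if t == k then y else x t.
have wE y : window k.+1 n x `&` [set w | SA k w = y] = window k n (x' y).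
  apply/seteqP; split=> w /=.
    move=> [wx wy] t /andP[kt tn]; rewrite /x'; case: eqVneq => [->//|tk].
    by apply: wx; rewrite tn andbT ltn_neqAle eq_sym tk.
  move=> wx; split=> [t /andP[kt tn]|].
    have := wx t; rewrite (ltnW kt) tn => /(_ isT) ->.
    by rewrite /x' gtn_eqF.
  by have := wx k; rewrite leqnn (ltnW kn) /x' eqxx => /(_ isT) ->.
have PrE y := etrans (congr1 Pr (wE y)) (IH (x' y) (ltnW kn)).
rewrite (eq_bigr _ (fun y _ => PrE y)).
rewrite sumEFin; congr EFin.
rewrite /= [RHS]mulrAC mulr_sumr; apply: eq_bigr => y _.
rewrite big_ltn// /x' eqxx gtn_eqF//.
rewrite (eq_big_nat _ _
  (F2 := fun t => P (x t).1 (x t).2 (x t.+1).1 * pi (x t.+1))).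
  ring.
by move=> t /andP[kt _]; rewrite !gtn_eqF// ltnW.
Qed.

Lemma marginal_law t y :
  Pr [set w | St t w = y.1 /\ At t w = y.2] = (state_action_law P mu pi t y)%:E.
Proof.
have := @window_law t t (fun=> y) (leqnn t).
rewrite big_geq// mulr1 => <-; congr (Pr _).
apply/seteqP; split=> w /= => [[+ +] u|wt].
  rewrite -eqn_leq => + + /eqP <-; rewrite /SA => -> ->.
  by rewrite -surjective_pairing.
by have := wt t; rewrite leqnn => /(_ isT) <-.
Qed.

Lemma occupancyE y :
  occupancy St At gamma Pr y = (1 - gamma) * discounted_law P mu gamma pi y.
Proof.
rewrite /occupancy /discounted_law.
by under eq_fun do rewrite marginal_law.
Qed.

(** Expectation and discounted sum commute by dominated convergence, the partial
sums being bounded by a geometric series. *)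
Lemma rewardE r :
  reward St At gamma r Pr = dot r (occupancy St At gamma Pr).
Proof.
have [g0 g1] := andP gamma_range.
pose C := \sum_y `|r y|.
have rC y : `|r y| <= C by rewrite /C (bigD1 y)//= lerDl sumr_ge0.
pose u w t := gamma ^+ t * r (SA t w).
have uC w t : `|u w t| <= geometric C gamma t.
  by rewrite normrM ger0_norm ?exprn_ge0// mulrC ler_wpM2r ?exprn_ge0.
have geoC : cvgn (series (geometric C gamma)).
  by apply: is_cvg_geometric_series; rewrite ger0_norm.
have cu w : cvgn (series (u w)).
  apply: normed_cvg; apply: (series_le_cvg _ _ _ geoC) => n.
  - exact: normr_ge0.
  - exact: le_trans (normr_ge0 _) (uC w n).
  - exact: uC.
have mX N : measurable_fun setT (fun w => series (u w) N).
  rewrite /series /=; apply: measurable_sum => t; apply: measurable_funM => //.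
  exact: (measurable_finite_valued (measurable_state_action t) r).
have Xcvg w : series (u w) N @[N --> \oo] --> limn (series (u w)) by exact: cu.
have Xbd w N : `|series (u w) N| <= limn (series (geometric C gamma)).
  apply: le_trans (ler_norm_sum _ _ _) _.
  apply: le_trans (ler_sum _ (fun t _ => uC w t)) _.
  apply: nondecreasing_cvgn_le => //.
  apply/nondecreasing_series => t _ _.
  exact: le_trans (normr_ge0 _) (uC w t).
have intX N : (\int[Pr]_w (series (u w) N)%:E =
    (\sum_y r y *
       series (fun t => gamma ^+ t * state_action_law P mu pi t y) N)%:E)%E.
  rewrite /series /=.
  under eq_integral do rewrite -sumEFin.
  under eq_integral do under eq_bigr do rewrite EFinM.
  have ir t : Pr.-integrable setT (fun w => (r (SA t w))%:E).
    apply: measurable_bounded_integrable => //.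
    - by rewrite (le_lt_trans (probability_le1 _ _))// ltry.
    - exact: (measurable_finite_valued (measurable_state_action t) r).
    - exists C; split; first exact: num_real.
      by move=> M CM w _ /=; apply: le_trans (rC _) (ltW CM).
  rewrite integral_sum//; last by move=> t; exact: integrableZl.
  have iZ t : (\int[Pr]_w ((gamma ^+ t)%:E * (r (SA t w))%:E) =
      (gamma ^+ t * \sum_y r y * fine (Pr [set w | SA t w = y]))%:E)%E.
    rewrite (integralZl measurableT (ir t)).
    by rewrite (integral_finite_valued Pr (measurable_state_action t) r) -EFinM.
  rewrite (eq_bigr _ (fun t _ => iZ t)).
  rewrite sumEFin; congr EFin.
  under [RHS]eq_bigr do rewrite mulr_sumr.
  rewrite [RHS]exchange_big; apply: eq_bigr => t _; rewrite mulr_sumr.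
  apply: eq_bigr => y _; rewrite mulrCA; congr (_ * (_ * _)).
  rewrite -[RHS]/(fine (state_action_law P mu pi t y)%:E) -marginal_law.
  congr (fine (Pr _)); apply/seteqP; split=> w /=; first by move=> <-.
  by case: (y) => s a [/= <- <-].
pose X N w := series (u w) N; pose Xoo w := limn (series (u w)).
pose bound : Omega -> R := cst (limn (series (geometric C gamma))).
have mXoo : measurable_fun setT Xoo.
  apply: (@measurable_fun_cvg _ _ _ _ X) => [n|w _]; first exact: mX.
  exact: Xcvg.
have mXE N : measurable_fun setT (EFin \o X N) by exact/measurable_EFinP/mX.
have mXooE : measurable_fun setT (EFin \o Xoo) by exact/measurable_EFinP.
have XE : {ae Pr, forall w, setT w ->
    (EFin \o X N) w @[N --> \oo] --> (EFin \o Xoo) w}.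
  by apply: aeW => w _; apply: cvg_EFin; [exact: nearW|exact: Xcvg].
have XboundE : {ae Pr, forall w N, setT w ->
    (`|(EFin \o X N) w| <= (EFin \o bound) w)%E}.
  by apply: aeW => w N _; rewrite /= lee_fin; exact: Xbd.
have ibound : Pr.-integrable setT (EFin \o bound).
  by apply: finite_measure_integrable_cst.
have [_ _ lim] := @dominated_convergence _ _ R Pr _ measurableT
  (fun N => EFin \o X N) _ _ mXE mXooE XE ibound XboundE.
rewrite /reward unlock /dot.
under [RHS]eq_bigr do rewrite occupancyE mulrCA.
rewrite -mulr_sumr; congr (_ * _).
rewrite -[RHS]/(fine (_%:E)); congr fine.
apply: cvg_unique lim _ => //.
rewrite /= (funext intX); apply: cvg_EFin; first exact: nearW.
apply: cvg_big => [|y _]; first by apply: add_continuous.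
by apply: cvgM; [exact: cvg_cst|exact: cvg_discounted_law].
Qed.

End mdp_process.

(** * The state-action polytope *)

Section occupancy_polytope.
Context {R : realType} {S A : finType}.
Variables (P : S -> A -> S -> R) (mu : S -> R) (gamma : R).
Hypothesis P_kernel : forall s a, simplex (P s a).
Hypothesis mu_simplex : simplex mu.
Hypothesis gamma_range : 0 <= gamma < 1.
Implicit Types (pi d v : S * A -> R) (s : S) (a : A).

(** The fixed-point equation is a linear system for the discounted law, with
coefficients affine in the policy, and it is invertible by [stationary_eq0]. *)
Lemma differentiable_discounted_law (V : normedModType R)
    (pol : V -> S * A -> R) (x : V) (y : S * A) :
  (forall th, policy (pol th)) ->
  (forall z, differentiable (fun th => pol th z) x) ->
  differentiable (fun th => discounted_law P mu gamma (pol th) y) x.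
Proof.
move=> polp dpol.
pose e := @enum_val (S * A)%type predT.
pose K th : 'M[R]_#|{: S * A}| := \matrix_(i, j)
  ((i == j)%:R - gamma * P (e i).1 (e i).2 (e j).1 * pol th (e j)).
pose z th : 'rV[R]_#|{: S * A}| :=
  \row_j discounted_law P mu gamma (pol th) (e j).
pose b th : 'rV[R]_#|{: S * A}| := \row_j (pol th (e j) * mu (e j).1).
have mulK (w : 'rV[R]_#|{: S * A}|) th j : (w *m K th) 0 j = w 0 j -
    pol th (e j) * (gamma * \sum_y w 0 (enum_rank y) * P y.1 y.2 (e j).1).
  rewrite mxE; under eq_bigr do rewrite mxE mulrBr.
  rewrite sumrB; congr (_ - _).
    rewrite (bigD1 j)//= eqxx mulr1 big1 ?addr0// => i /negbTE ->.
    by rewrite mulr0.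
  rewrite [RHS](_ : _ = \sum_y w 0 (enum_rank y) *
                          (gamma * P y.1 y.2 (e j).1 * pol th (e j))).
    rewrite [RHS](reindex e) /=; last exact/onW_bij/enum_val_bij.
    by apply: eq_bigr => i _; rewrite enum_valK.
  by rewrite !mulr_sumr; apply: eq_bigr => i _; ring.
have K0 th : \det (K th) != 0.
  apply/negP => /det0P[w w0 wK]; case/negP: w0; apply/eqP/rowP => j.
  rewrite mxE -(enum_valK j); move: (enum_val j) => {j}.
  apply: (stationary_eq0 P_kernel gamma_range (polp th)) => y' /=.
  have := congr1 (fun m : 'rV__ => m 0 (enum_rank y')) wK.
  by rewrite mulK mxE /e enum_rankK => /eqP; rewrite subr_eq0 => /eqP.
have zK th : z th *m K th = b th.
  apply/rowP => j; rewrite mulK.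
  under eq_bigr do rewrite mxE /e enum_rankK.
  have zE := discounted_lawE P_kernel mu_simplex gamma_range (e j) (polp th).
  rewrite !mxE zE.
  by rewrite mulrDr addrK.
have := @differentiable_cramer _ _ _ K b z x _ _ K0 zK (enum_rank y).
rewrite (_ : (fun th => z th 0 _) =
             fun th => discounted_law P mu gamma (pol th) y); last first.
  by apply/funext => th; rewrite mxE /e enum_rankK.
apply.
- move=> i j; under eq_fun do rewrite mxE.
  apply: differentiableB; first exact: differentiable_cst.
  by apply: differentiableM; first exact: differentiable_cst.
- move=> j; under eq_fun do rewrite mxE.
  by apply: differentiableM; last exact: differentiable_cst.
Qed.

Definition occupancy_measure pi y : R :=
  (1 - gamma) * discounted_law P mu gamma pi y.

Definition occupancy_polytope : set (S * A -> R) :=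
  [set occupancy_measure pi | pi in policy].

(** Its pairing with a state-action vector is the mass at [s] minus gamma times
the mass transported into [s], see [dot_bellman]. *)
Definition bellman s : S * A -> R :=
  fun y => (y.1 == s)%:R - gamma * P y.1 y.2 s.

Lemma dot_bellman d s : dot d (bellman s) =
  \sum_a d (s, a) - gamma * \sum_y d y * P y.1 y.2 s.
Proof.
rewrite /dot /bellman; under eq_bigr do rewrite mulrBr.
rewrite sumrB sum_state_action; congr (_ - _).
  rewrite (bigD1 s)//= [X in _ + X]big1 ?addr0 => [|s' /negbTE ss'].
    by apply: eq_bigr => a _; rewrite eqxx mulr1.
  by apply: big1 => a _; rewrite ss' mulr0.
by rewrite mulr_sumr; apply: eq_bigr => y _; rewrite mulrCA.
Qed.

Lemma sum_dot_bellman d : \sum_s dot d (bellman s) = (1 - gamma) * \sum_y d y.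
Proof.
under eq_bigr do rewrite dot_bellman.
rewrite sumrB -mulr_sumr (kernel_sum P_kernel) -sum_state_action.
by rewrite mulrBl mul1r.
Qed.

Lemma dot_bellman_occupancy pi s : policy pi ->
  dot (occupancy_measure pi) (bellman s) = (1 - gamma) * mu s.
Proof.
move=> pip; rewrite dot_bellman /occupancy_measure.
have zE y := discounted_lawE P_kernel mu_simplex gamma_range y pip.
under eq_bigr do rewrite zE mulrCA.
rewrite /= -mulr_suml (pip s).2 mul1r.
under [X in _ - _ * X]eq_bigr do rewrite -mulrA.
by rewrite -mulr_sumr; ring.
Qed.

Lemma occupancy_measure_ge0 pi y : policy pi -> 0 <= occupancy_measure pi y.
Proof.
move=> pip; have /andP[_ g1] := gamma_range.
by apply: mulr_ge0; [rewrite subr_ge0 ltW|exact: discounted_law_ge0].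
Qed.

Lemma occupancy_measure_simplex pi :
  policy pi -> simplex (occupancy_measure pi).
Proof.
move=> pip; split=> [y|]; first exact: occupancy_measure_ge0.
have g1 : 1 - gamma != 0 by rewrite gt_eqF// subr_gt0; case/andP: gamma_range.
apply: (mulfI g1); rewrite -sum_dot_bellman mulr1.
under eq_bigr do rewrite dot_bellman_occupancy//.
by rewrite -mulr_sumr mu_simplex.2 mulr1.
Qed.

(** The value at (s, a) is pi(a|s) times a factor depending on s only. If it
vanished, so would the whole mass of the state s. *)
Lemma occupancy_measure_gt0 pi : policy pi -> (forall y, 0 < pi y) ->
  (forall s, 0 < \sum_a occupancy_measure pi (s, a)) ->
  forall y, 0 < occupancy_measure pi y.
Proof.
move=> pip pi0 visited [s a]; rewrite lt_neqAle occupancy_measure_ge0// andbT.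
apply/eqP => /esym occ0; have := visited s; rewrite big1 ?ltxx// => a' _.
move: occ0; rewrite /occupancy_measure.
rewrite !(discounted_lawE P_kernel mu_simplex gamma_range _ pip) /=.
move=> /eqP; rewrite !mulf_eq0 (gt_eqF (pi0 _))/= => /orP[]/eqP ->.
  by rewrite mul0r.
by rewrite !mulr0.
Qed.

(** The conditional distribution pi(a|s) = d(s, a) / rho(s) is a policy, and d
and its state-action distribution solve the same fixed-point equation. A given
policy is needed to know that there are actions at all. *)
Lemma occupancy_polytope_pos d : (exists pi : S * A -> R, policy pi) ->
  (forall y, 0 < d y) -> (forall s, dot d (bellman s) = (1 - gamma) * mu s) ->
  occupancy_polytope d.
Proof.
move=> [pi0 pi0p] dpos dflow.
pose rho s := \sum_a d (s, a).
have rho_pos s : 0 < rho s.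
  rewrite /rho; have := (pi0p s).2.
  case: (pickP (@predT A)) => [a _ _|A0]; last first.
    by rewrite big_pred0// => /esym/eqP; rewrite oner_eq0.
  by rewrite (bigD1 a)//= ltr_pwDl// sumr_ge0// => *; exact: ltW.
pose pi y := d y / rho y.1.
have pip : policy pi.
  move=> s; split=> [a|]; first by rewrite divr_ge0// ltW// rho_pos.
  by rewrite /pi /= -mulr_suml; apply: mulfV; rewrite gt_eqF// rho_pos.
exists pi => //; apply/funext => y; apply/eqP; rewrite -subr_eq0; apply/eqP.
move: y; apply: (stationary_eq0 P_kernel gamma_range pip) => y.
have dE s : rho s = (1 - gamma) * mu s + gamma * \sum_y d y * P y.1 y.2 s.
  by rewrite -dflow dot_bellman subrK.
have -> : d y = pi y * rho y.1 by rewrite divfK// gt_eqF.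
rewrite /occupancy_measure.
rewrite {1}(discounted_lawE P_kernel mu_simplex gamma_range _ pip) dE.
under [X in _ = _ * (_ * X)]eq_bigr do rewrite mulrBl -mulrA.
by rewrite sumrB -mulr_sumr; ring.
Qed.

(** A vector v satisfying the homogeneous constraints can be added to a positive
point d with a small factor e, without leaving the polytope, so v is a multiple
of a difference of two of its points. *)
Lemma tangent_occupancy_polytope d :
  occupancy_polytope d -> (forall y, 0 < d y) ->
  tangent occupancy_polytope = [set v | forall s, dot v (bellman s) = 0].
Proof.
move=> Dd dpos.
have hullE u : affine_hull occupancy_polytope u ->
    forall s, dot u (bellman s) = (1 - gamma) * mu s.
  move=> [n [c [w [c1 Dw ->]]]] s.
  have -> : dot (\sum_i c i *: w i) (bellman s) =
      \sum_i c i * dot (w i) (bellman s).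
    rewrite /dot; under [RHS]eq_bigr do rewrite mulr_sumr.
    rewrite [RHS]exchange_big; apply: eq_bigr => y _.
    rewrite fct_sumE mulr_suml; apply: eq_bigr => i _.
    by rewrite mulrA.
  under eq_bigr => i _.
    have [pi pip <-] := Dw i; rewrite dot_bellman_occupancy//.
    over.
  by rewrite -mulr_suml c1 mul1r.
apply/seteqP; split=> [v [u [w [hu hw ->]]] s|v v0].
  rewrite /dot; under eq_bigr do rewrite mulrBl.
  by rewrite sumrB [X in X - _](hullE _ hu) [X in _ - X](hullE _ hw) subrr.
(* Small enough that e |v y| < d y for every y. *)
pose e := (\sum_y (1 + `|v y|) / d y + 1)^-1.
have dV y : 0 < (1 + `|v y|) / d y by rewrite divr_gt0// ltr_pwDl.
have e0 : 0 < e by rewrite invr_gt0 ltr_wpDl// sumr_ge0// => y _; exact: ltW.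
have dev y : 0 < d y + e * v y.
  have le1 : (1 + `|v y|) / d y < e^-1.
    rewrite invrK (bigD1 y)//= -addrA ltr_pwDr// ltr_wpDl// sumr_ge0// => z _.
    exact: ltW.
  have : e * (1 + `|v y|) < d y.
    move: le1; rewrite ltr_pdivrMr// -(ltr_pM2l e0) mulrA.
    by rewrite mulfV ?mul1r// gt_eqF.
  have := ler_norm (- v y); rewrite normrN => vy.
  have : e * - v y <= e * (1 + `|v y|) by rewrite ler_wpM2l 1?ltW//; lra.
  lra.
clearbody e.
have Dv : occupancy_polytope (fun y => d y + e * v y).
  apply: occupancy_polytope_pos => // [|s].
    by case: Dd => pi pip _; exists pi.
  rewrite /dot; under eq_bigr do rewrite mulrDl -mulrA.
  rewrite big_split/= -mulr_sumr [X in _ + _ * X](v0 s) mulr0 addr0.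
  by case: Dd => pi pip <-; exact: dot_bellman_occupancy.
exists (e^-1 *: (fun y => d y + e * v y) + (1 - e^-1) *: d), d; split.
- exists 2%N, (fun i => if i == 0 then e^-1 else 1 - e^-1).
  exists (fun i => if i == 0 then (fun y => d y + e * v y) else d); split.
  + by rewrite big_ord_recl big_ord1/= subrKC.
  + by move=> i; case: ifP.
  + by rewrite big_ord_recl big_ord1.
- exists 1%N, (fun=> 1), (fun=> d); split=> //.
  + by rewrite big_ord1.
  + by rewrite big_ord1 scale1r.
- apply/funext => y.
  transitivity (e^-1 * (d y + e * v y) + (1 - e^-1) * d y - d y); last by [].
  by field; rewrite gt_eqF.
Qed.

End occupancy_polytope.

(** If pi(a|s) = 0, moving away from a policy that plays a in s stays in the
affine hull but makes the entry at (s, a) negative. *)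
Lemma relint_policy_gt0 (R : realType) (S A : finType) (pi : S * A -> R) :
  relint policy pi -> forall y, 0 < pi y.
Proof.
move=> [pip [e e0 near_pi]] [s a]; have pi0 y : 0 <= pi y.
  by case: y => s' a'; exact: (pip s').1.
rewrite lt_neqAle pi0 andbT eq_sym; apply/negP => /eqP piy0.
pose pi' y := if y.1 == s then (y.2 == a)%:R else pi y.
have pi'p : policy pi'.
  move=> s'; rewrite /pi' /=; case: eqP => [_|_]; last exact: pip.
  split=> [a'|]; first exact: ler0n.
  by rewrite (bigD1 a)//= eqxx big1 ?addr0// => i /negbTE ->.
have le1 (q : S * A -> R) y : policy q -> 0 <= q y <= 1.
  move=> qp; case: y => s' a'; rewrite (qp s').1/= -(qp s').2.
  by rewrite (bigD1 a')//= lerDl sumr_ge0// => i _; exact: (qp s').1.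
pose h := e / 2.
have h0 : 0 < h by rewrite divr_gt0.
pose w := (1 + h) *: pi + (- h) *: pi'.
have : policy w.
  apply: near_pi.
    exists 2%N, (fun i => if i == 0 then 1 + h else - h).
    exists (fun i => if i == 0 then pi else pi'); split.
    - by rewrite big_ord_recl big_ord1/= addrK.
    - by move=> i; case: ifP.
    - by rewrite big_ord_recl big_ord1.
  move=> y; have -> : w y - pi y = h * (pi y - pi' y).
    by transitivity ((1 + h) * pi y + - h * pi' y - pi y); [|ring].
  have := le1 _ y pip; have := le1 _ y pi'p => /andP[? ?] /andP[? ?].
  have n1 : `|pi y - pi' y| <= 1 by rewrite ler_norml; apply/andP; split; lra.
  rewrite normrM (gtr0_norm h0).
  by apply: le_lt_trans (ler_wpM2l (ltW h0) n1) _; rewrite /h; lra.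
move=> /(_ s)[/(_ a)+ _].
change (0 <= (1 + h) * pi (s, a) + - h * pi' (s, a) -> False).
by rewrite piy0 /pi' /= !eqxx mulr0 add0r mulr1 oppr_ge0 leNgt h0.
Qed.

(** * Natural policy gradient flows *)

Unset Implicit Arguments.
Set Strict Implicit.

Theorem corollary5p4
  (R : realType) (S A : finType)
  (P : S -> A -> S -> R) (mu : S -> R) (r : S * A -> R) (gamma : R)
  (P_kernel : forall s a, simplex (P s a))
  (mu_simplex : simplex mu)
  (gamma_range : 0 <= gamma < 1)
  (dsp : measure_display) (Omega : measurableType dsp)
  (St : nat -> Omega -> S) (At : nat -> Omega -> A)
  (Pr : (S * A -> R) -> probability Omega R)
  (Pr_law : forall pi, policy pi -> is_mdp_law St At P mu pi (Pr pi))
  (dist := fun pi : S * A -> R => occupancy St At gamma (Pr pi))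
  (Rew := fun pi : S * A -> R => reward St At gamma r (Pr pi))
  (D := [set dist pi | pi in policy])
  (visited : forall pi, policy pi -> forall s, 0 < \sum_a dist pi (s, a))
  (p : nat) (pol : 'cV[R]_p -> S * A -> R)
  (pol_int : forall th, relint policy (pol th))
  (pol_diff : forall (th : 'cV[R]_p) x, differentiable (fun th' => pol th' x) th)
  (d := fun th => dist (pol th))
  (theta : R -> 'cV[R]_p)
  (flow : forall t : R, 0 <= t -> has_derivative_nonneg theta t
     (moore_penrose (gram d (theta t)) *m
        nabla (fun th => Rew (pol th)) (theta t)))
  (Rstar := sup [set Rew pi | pi in policy])
  (dstar : S * A -> R) (dstar_D : D dstar) (dstar_opt : dot r dstar = Rstar)
  (delta := fun t => Num.sqrt (chi2 dstar (d (theta t))))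
  (eps := fun t => Num.sqrt (eps2 d D (dot r) (theta t))) :
  (forall t : R, 0 < t ->
     ((Rstar - Rew (pol (theta t)))%:E
       <= (DKL dstar (d (theta 0)) / t)%:E
          + (t^-1)%:E * \int[lebesgue_measure]_(s in `[0%R, t])
                          (delta s * eps s)%:E)%E) /\
  (forall t : R, 0 <= t -> eps t ^+ 2 <= compatible_error d r (theta t)).
Proof.
have pol_p th : policy (pol th) by have [] := pol_int th.
have distE pi : policy pi -> dist pi = occupancy_measure P mu gamma pi.
  by move=> pip; apply/funext => y; exact: (occupancyE gamma (Pr_law pi pip)).
have DE : D = occupancy_polytope P mu gamma.
  by apply/seteqP; split=> _ [pi pip <-]; exists pi => //; rewrite distE.
have RewE pi : policy pi -> Rew pi = dot r (dist pi).
  move=> pip.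
  exact: (rewardE P_kernel mu_simplex gamma_range pip (Pr_law pi pip)).
have D_simplex u : D u -> simplex u.
  by rewrite DE => -[pi pip <-]; exact: occupancy_measure_simplex.
have d_D th : D (d th) by exists (pol th).
have d_gt0 th x : 0 < d th x.
  rewrite /d distE//; apply: occupancy_measure_gt0 => // [|s].
    exact: relint_policy_gt0.
  by rewrite -distE//; exact: visited.
have d_diff th x : differentiable (d ^~ x) th.
  rewrite (_ : d ^~ x = fun th' =>
      (1 - gamma) * discounted_law P mu gamma (pol th') x).
    by apply: differentiableM => //; exact: differentiable_discounted_law.
  by apply/funext => th'; rewrite /d distE.
have D_tangent : tangent D = [set v | forall s, dot v (bellman P gamma s) = 0].
  have Dd0 : occupancy_polytope P mu gamma (d 0) by rewrite -DE.
  rewrite DE.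
  exact: (tangent_occupancy_polytope P_kernel mu_simplex gamma_range Dd0
    (d_gt0 0)).
have RewdE : (fun th => Rew (pol th)) = (fun th => dot r (d th)).
  by apply/funext => th; exact: RewE.
rewrite RewdE in flow.
split=> [t t0|t t0].
  rewrite RewE// -dstar_opt.
  exact: (natural_gradient_flow_bound D_simplex D_tangent d_D d_gt0 d_diff
    flow dstar_D t0).
rewrite /eps sqr_sqrtr.
  exact: (eps2_le_compatible_error r D_tangent d_D d_gt0 d_diff).
have [w ->] := eps2_attained D (dot r) (fun x => ltW (d_gt0 (theta t) x)).
exact: sqr_ge0.
Qed.
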